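(* Let $D(x_0)=\theta_0^2\Delta(x_0)=(1-\theta_0)(F(x_0)-F(x_* ))+\frac12\|x_0-x_*\|_v^2$. Let $\mu\in(0,1]$ and $\epsilon>0$, and choose $$K=\left\lceil\frac{2\sqrt3}{\theta_0}\sqrt{1+\frac1\mu}-\frac{2}{\theta_0}+1\right\rceil,\qquad \sigma=\frac{1}{1+m_K(\mu)}.$$ Let $(x_k)$ be the iterates of the algorithm APPROX+restart with parameters $K$ and $\sigma$ (as defined in the context). Then for $$k\ge\frac n\tau\left(6\sqrt6\max\left(\frac{1}{\sqrt\mu},\frac{\sqrt\mu}{\mu_F(v)}\right)\log\left(\frac{D(x_0)}{\epsilon}\right)+2\sqrt3\sqrt{1+\frac1\mu}\right),$$ we have $$\mathbf{E}\left[(1-\theta_0)(F(x_k)-F(x_* ))+\frac12\|x_k-x_*\|_v^2\right]\le\epsilon.$$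
   Context: Problem: $f:\mathbb{R}^n\to\mathbb{R}$ is convex and differentiable; $\psi(x)=\sum_{i=1}^n\psi^i(x^i)$ where each $\psi^i:\mathbb{R}\to\mathbb{R}\cup\{+\infty\}$ is closed and convex; $F=f+\psi$; $x_*$ is a minimizer of $F$; $\operatorname{dom}\psi=\{x:\psi(x)<+\infty\}$. For a vector $v$ with positive entries, $\|x\|_v^2=\sum_{i=1}^n v_i(x^i)^2$. Strong convexity assumption: $\mu_F(v)>0$ is a constant such that $F(x)\ge F(x_* )+\frac{\mu_F(v)}{2}\|x-x_*\|_v^2$ for all $x\in\mathbb{R}^n$. Sampling: $\hat S$ is a random subset of $\{1,\dots,n\}$ with $\mathbf{P}(i\in\hat S)=\mathbf{P}(j\in\hat S)$ for all $i,j$, and $\tau=\mathbf{E}[|\hat S|]>0$. ESO assumption: for all $x,h\in\mathbb{R}^n$, $\mathbf{E}[f(x+h_{[\hat S]})]\le f(x)+\frac{\tau}{n}\left(\langle\nabla f(x),h\rangle+\frac12\|h\|_v^2\right)$, where $h_{[S]}=\sum_{i\in S}h^ie_i$ and $e_i$ is the $i$th standard basis vector. Reference sequence and coefficients: $\vartheta_0=\theta_0=\tau/n$, $\vartheta_{j+1}=\frac{\sqrt{\vartheta_j^4+4\vartheta_j^2}-\vartheta_j^2}{2}$, and $\frac{1}{\vartheta_{-1}^2}:=\frac{1-\vartheta_0}{\vartheta_0^2}$. Set $\gamma_0^0=1$, $\gamma_1^0=0$, $\gamma_1^1=1$, and for $j\ge1$: $\gamma_{j+1}^i=(1-\vartheta_j)\gamma_j^i$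 for $i=0,\dots,j-1$; $\gamma_{j+1}^j=\vartheta_j(1-\frac n\tau\vartheta_{j-1})+\frac n\tau(\vartheta_{j-1}-\vartheta_j)$; $\gamma_{j+1}^{j+1}=\frac n\tau\vartheta_j$. For $j\ge1$ let $W_j=\sum_{i=0}^{j-1}\frac{\gamma_j^i}{\vartheta_{i-1}^2}+\frac{1}{\vartheta_0\vartheta_{j-1}}-\frac{1-\vartheta_0}{\vartheta_0^2}$ and $m_j(\mu)=\frac{\mu\theta_0^2}{1+\mu(1-\theta_0)}W_j$. Also $\Delta(x)=\frac{1-\theta_0}{\theta_0^2}(F(x)-F(x_* ))+\frac{1}{2\theta_0^2}\|x-x_*\|_v^2$. Algorithm APPROX+restart (parameters $K\ge1$ integer, $\sigma\in(0,1)$): choose $x_0\in\operatorname{dom}\psi$, $z_0=x_0$, $\theta_0=\tau/n$, last restart index $s=0$. For $k=0,1,2,\dots$: (1) $y_k=(1-\theta_k)x_k+\theta_kz_k$; (2) draw $S_k\sim\hat S$ independently of the past; for $i\in S_k$ set $z_{k+1}^i=\arg\min_{z\in\mathbb{R}}\{\langle\nabla_if(y_k),z-y_k^i\rangle+\frac{\theta_knv_i}{2\tau}|z-z_k^i|^2+\psi^i(z)\}$ ($\nabla_i f$ is the $i$th partial derivative), and $z_{k+1}^i=z_k^i$ for $i\notin S_k$; (3) $x_{k+1}=y_k+\frac n\tau\theta_k(z_{k+1}-z_k)$; (4) $\theta_{k+1}=\frac{\sqrt{\theta_k^4+4\theta_k^2}-\theta_k^2}{2}$; (5) if $k\equiv0\bmod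 K$, restart: with $j=k+1-s$ (number of iterations since the last restart) put $\mathring x_{k+1}=\frac{1}{W_j}\left(\sum_{i=0}^{j-1}\frac{\gamma_j^i}{\vartheta_{i-1}^2}x_{s+i}+\left(\frac{1}{\vartheta_0\vartheta_{j-1}}-\frac{1-\vartheta_0}{\vartheta_0^2}\right)x_{k+1}\right)$ and $\bar x_{k+1}=\sigma x_{k+1}+(1-\sigma)\mathring x_{k+1}$, then replace $x_{k+1}\leftarrow\bar x_{k+1}$, $z_{k+1}\leftarrow\bar x_{k+1}$, $\theta_{k+1}\leftarrow\theta_0$, $s\leftarrow k+1$. The iterate $x_k$ denotes the value after any such replacement. *)

(* Defs.v *)
From HB Require Import structures.
From mathcomp Require Import all_boot all_order all_algebra.
From mathcomp Require Import all_classical all_reals all_analysis.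
Set Implicit Arguments.
Unset Strict Implicit.
Unset Printing Implicit Defensive.
Import Order.TTheory GRing.Theory Num.Theory.
Import numFieldNormedType.Exports.
Local Open Scope classical_set_scope.
Local Open Scope ring_scope.

Definition wnorm2 (R : realType) (n : nat) (v : 'I_n -> R) (x : 'rV[R]_n) : R :=
  \sum_(i < n) v i * x 0 i ^+ 2.

Definition partial (R : realType) (n : nat) (f : 'rV[R]_n -> R) (i : 'I_n)
  (x : 'rV[R]_n) : R := 'D_(delta_mx 0 i) f x.

Definition restrict_to (R : realType) (n : nat) (A : {set 'I_n})
  (h : 'rV[R]_n) : 'rV[R]_n := \sum_(i in A) h 0 i *: delta_mx 0 i.

(* Since 0 * +oo = 0 in \bar R, the convexity inequality is trivial at t = 0
   and t = 1, even outside the domain of g. *)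
Definition closed_convex (R : realType) (g : R -> \bar R) : Prop :=
  [/\ forall a : R, g a != -oo%E,
      closed [set p : R * R | (g p.1 <= p.2%:E)%E] &
      forall a b t : R, 0 <= t -> t <= 1 ->
        (g (t * a + (1 - t) * b)%R <= t%:E * g a + (1 - t)%:E * g b)%E].

Definition separable (R : realType) (n : nat) (psi : 'I_n -> R -> \bar R)
  (x : 'rV[R]_n) : \bar R := (\sum_(i < n) psi i (x 0%R i))%E.

Definition edom (T : Type) (R : realType) (g : T -> \bar R) : set T :=
  [set x | (g x < +oo)%E].

Definition objective (R : realType) (n : nat) (f : 'rV[R]_n -> R)
  (psi : 'I_n -> R -> \bar R) (x : 'rV[R]_n) : \bar R :=
  ((f x)%:E + separable psi x)%E.

Definition is_minimizer (T : Type) (R : realType) (g : T -> \bar R) (x : T) : Prop :=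
  forall y, (g x <= g y)%E.

Section Probability.
Context d (T : measurableType d) (R : realType) (P : probability T R).

(* U is meant to be finite and carries its discrete sigma-algebra. *)
Definition discrete_measurable_map (U : Type) (X : T -> U) : Prop :=
  forall B : set U, measurable (X @^-1` B).

Definition same_law (U : Type) (X Y : T -> U) : Prop :=
  forall B : set U, P (X @^-1` B) = P (Y @^-1` B).

Definition mutually_independent (U : Type) (X : nat -> T -> U) : Prop :=
  forall (J : seq nat) (B : nat -> set U), uniq J ->
    P (\bigcap_(k in [set` J]) (X k @^-1` B k)) =
    (\prod_(k <- J) P (X k @^-1` B k))%E.

End Probability.

Definition theta_step (R : realType) (t : R) : R :=
  (Num.sqrt (t ^+ 4 + 4 * t ^+ 2) - t ^+ 2) / 2.

Definition vtheta (R : realType) (n : nat) (tau : R) (j : nat) : R :=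
  iter j (@theta_step R) (tau / n%:R).

(* [inv_vtheta_pred_sq n tau i] is 1 / vtheta_(i-1) ^ 2, with the convention
   1 / vtheta_(-1) ^ 2 = (1 - vtheta_0) / vtheta_0 ^ 2. *)
Definition inv_vtheta_pred_sq (R : realType) (n : nat) (tau : R) (i : nat) : R :=
  if i is i'.+1 then 1 / vtheta n tau i' ^+ 2
  else (1 - vtheta n tau 0) / vtheta n tau 0 ^+ 2.

(* [gamma n tau j i] is gamma_j^i (0 for i > j).  In the last branch the row
   index is j + 1 with j = j'.+1, so vtheta_(j-1) is [vtheta n tau j']. *)
Fixpoint gamma (R : realType) (n : nat) (tau : R) (j i : nat) : R :=
  match j with
  | 0 => if i == 0%N then 1 else 0
  | 1 => if i == 1%N then 1 else 0
  | (j'.+1 as j).+1 =>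
      if (i < j)%N then (1 - vtheta n tau j) * gamma n tau j i
      else if i == j then
        vtheta n tau j * (1 - n%:R / tau * vtheta n tau j')
        + n%:R / tau * (vtheta n tau j' - vtheta n tau j)
      else if i == j.+1 then n%:R / tau * vtheta n tau j
      else 0
  end.

(* Weight of the last point, for j >= 1. *)
Definition last_weight (R : realType) (n : nat) (tau : R) (j : nat) : R :=
  1 / (vtheta n tau 0 * vtheta n tau j.-1)
  - (1 - vtheta n tau 0) / vtheta n tau 0 ^+ 2.

Definition Wsum (R : realType) (n : nat) (tau : R) (j : nat) : R :=
  \sum_(i < j) gamma n tau j i * inv_vtheta_pred_sq n tau i
  + last_weight n tau j.

Definition mcoef (R : realType) (n : nat) (tau : R) (j : nat) (mu : R) : R :=
  let theta0 := tau / n%:R in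
  mu * theta0 ^+ 2 / (1 + mu * (1 - theta0)) * Wsum n tau j.

(* One realization of the algorithm, for the sampled blocks [S 0, S 1, ...].
   [xplus k] and [zplus k] are x_(k+1) and z_(k+1) before the possible restart;
   [x k], [z k], [theta k], [s k] are the values after it. *)
Definition approx_restart (R : realType) (n : nat) (f : 'rV[R]_n -> R)
    (psi : 'I_n -> R -> \bar R) (v : 'I_n -> R) (tau : R) (K : nat) (sigma : R)
    (x0 : 'rV[R]_n) (S : nat -> {set 'I_n}) (x : nat -> 'rV[R]_n) : Prop :=
  exists (y z xplus zplus : nat -> 'rV[R]_n) (theta : nat -> R) (s : nat -> nat),
  [/\ x 0%N = x0, z 0%N = x0, theta 0%N = tau / n%:R, s 0%N = 0%N &
   forall k : nat,
   [/\ y k = (1 - theta k) *: x k + theta k *: z k,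
       forall i : 'I_n,
         if i \in S k then
           is_minimizer
             (fun t : R => ((partial f i (y k) * (t - y k 0 i)
                + theta k * n%:R * v i / (2 * tau) * `|t - z k 0 i| ^+ 2)%:E
                + psi i t)%E)
             (zplus k 0 i)
         else zplus k 0 i = z k 0 i,
       xplus k = y k + (n%:R / tau * theta k) *: (zplus k - z k) &
       if (K %| k)%N then
         let j := (k.+1 - s k)%N in
         let xring := (Wsum n tau j)^-1 *:
           (\sum_(i < j) (gamma n tau j i * inv_vtheta_pred_sq n tau i)
                           *: x (s k + i)%N
            + last_weight n tau j *: xplus k) in
         let xbar := sigma *: xplus k + (1 - sigma) *: xring in
         [/\ x k.+1 = xbar, z k.+1 = xbar,
             theta k.+1 = tau / n%:R & s k.+1 = k.+1]
       else
         [/\ x k.+1 = xplus k, z k.+1 = zplus k,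
             theta k.+1 = theta_step (theta k) & s k.+1 = s k]]].

(* (1 - theta0) (F x - F xs) + 1/2 ||x - xs||_v^2, i.e. theta0^2 Delta(x). *)
Definition Dfun (R : realType) (n : nat) (f : 'rV[R]_n -> R)
    (psi : 'I_n -> R -> \bar R) (v : 'I_n -> R) (tau : R) (xs x : 'rV[R]_n) : \bar R :=
  ((1 - tau / n%:R)%:E * (objective f psi x - objective f psi xs)
   + (1 / 2 * wnorm2 v (x - xs))%:E)%E.

(* Main.v *)
(* Within a period started at [x_s], every [x_j] is the convex combination
   [sum_i gamma_j^i z_i], and
   [(hatF_j - Fmin) / vtheta_(j-1)^2 + |z_j - xmin|_v^2 / (2 theta_0^2)] is a
   supermartingale: this follows from the ESO, the three-point inequality of the
   proximal step and the gradient inequality.  Summing with the weights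
   [gamma_j^i] and using convexity,
   [E (W_j (F(ring x_j) - Fmin) + Delta(x_j)) <= E Delta(x_s)].
   Strong convexity bounds [Delta(ring x_j)] by the gap at [ring x_j], so a period
   of length [K] contracts [E Delta] by [max (sigma, 1 - sigma m_K(mu_F))].
   With [a_i = 1 / vtheta_i] one has [a_i >= 1 / theta_0 + i / 2] and
   [W_K >= a_(K-1)^2 / 3], so the chosen [K] makes [m_K(mu) >= 1] and the factor
   is at most [1 - min (1, mu_F / mu) / 2].
   The iterates after [k] steps depend only on the sampled history of length [k],
   because proximal points are unique; all expectations are thus finite sums. *)
Require Import Defs.
From HB Require Import structures.
From mathcomp Require Import all_boot all_order all_algebra.
From mathcomp Require Import all_classical all_reals all_analysis.
From mathcomp Require Import ring lra.
Set Implicit Arguments.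
Unset Strict Implicit.
Unset Printing Implicit Defensive.
Import Order.TTheory GRing.Theory Num.Theory.
Import numFieldNormedType.Exports.
Local Open Scope classical_set_scope.
Local Open Scope ring_scope.

(** * Coefficients *)

(** The obstacle is that [x_(k+1)] extrapolates beyond [y_k]: written with [x_k], [z_k] and
    [z_(k+1)], its coefficient of [z_k] is [theta_k (1 - n / tau)], which is not positive, so
    convexity gives no one-step bound on [psi x_(k+1)]. Over a whole period the coefficients become
    nonnegative. The combination of the values [psi z_l] with these coefficients dominates
    [psi x_(k+1)] and depends on the new sample only through a separable function of [z_(k+1)],
    whose mean needs nothing but the marginals of the sampling; this is the part of hatF that
    replaces [psi]. Iteration 0 already ends in a restart, because [K] divides 0. Of this period of
    length one only the absence of growth is used, so [k] iterations provide [(k - 1) %/ K]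
    contracting periods. The summand [2 sqrt 3 sqrt (1 + 1 / mu)] in the bound on [k] pays for this
    loss. The two demands on [K] are met by one inequality, [a_(K-1) >= q / theta_0] with
    [q^2 = 3 (1 + 1 / mu)]: it makes [m_K(mu) >= 1], and [mu <= 1] gives [q^2 >= 6], the threshold
    above which [W_K >= a_(K-1)^2 / 3] is available. *)

Section Coefficients.
Context (R : realType) (n : nat) (tau : R).
Local Notation th0 := (tau / n%:R).
Hypothesis th0_gt0 : 0 < th0.
Hypothesis th0_le1 : th0 <= 1.
Local Notation vt := (vtheta n tau).
Local Notation inv := (inv_vtheta_pred_sq n tau).
Local Notation gam := (gamma n tau).

Lemma theta_step_spec (t : R) : 0 < t ->
  [/\ 0 < theta_step t, theta_step t < t &
      theta_step t ^+ 2 = (1 - theta_step t) * t ^+ 2].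
Proof.
move=> t0; rewrite /theta_step; set D := t ^+ 4 + 4 * t ^+ 2.
have D0 : 0 <= D by rewrite /D; nra.
have := sqr_sqrtr D0; have := sqrtr_ge0 D; set r := Num.sqrt D => r0 rE.
have t2 : 0 < t ^+ 2 by rewrite exprn_gt0.
have h1 : t ^+ 2 < r.
  rewrite ltNge; apply/negP => h.
  have : r ^+ 2 <= (t ^+ 2) ^+ 2 by rewrite lerXn2r ?nnegrE// ltW.
  by rewrite rE /D; nra.
have h2 : r < t ^+ 2 + 2 * t.
  rewrite ltNge; apply/negP => h.
  have : (t ^+ 2 + 2 * t) ^+ 2 <= r ^+ 2 by rewrite lerXn2r ?nnegrE//; nra.
  by rewrite rE /D; nra.
split; [by lra|by lra|].
have -> : ((r - t ^+ 2) / 2) ^+ 2 = (r ^+ 2 - 2 * r * t ^+ 2 + t ^+ 4) / 4 by field.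
by rewrite rE /D; field.
Qed.

Lemma vtheta_gt0 j : 0 < vt j.
Proof. by elim: j => [//|j IH]; case: (theta_step_spec IH). Qed.

Lemma vtheta0 : vt 0 = th0. Proof. by []. Qed.

Lemma vtheta_ltS j : vt j.+1 < vt j.
Proof. by case: (theta_step_spec (vtheta_gt0 j)). Qed.

Lemma vtheta_le j : vt j <= th0.
Proof. by elim: j => [//|j IH]; apply: le_trans IH; apply/ltW/vtheta_ltS. Qed.

Lemma vtheta_le1 j : vt j <= 1.
Proof. exact: le_trans (vtheta_le j) th0_le1. Qed.

Lemma vthetaS_sq j : vt j.+1 ^+ 2 = (1 - vt j.+1) * vt j ^+ 2.
Proof. by case: (theta_step_spec (vtheta_gt0 j)). Qed.

(** The recursion [vthetaS_sq] turns [1 / vtheta_(j-1) ^ 2] into this expression in [vtheta_j]; the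
    convention at index -1 is the one that extends the identity to [j = 0]. *)
Lemma inv_vtheta_predE j : inv j = (1 - vt j) / vt j ^+ 2.
Proof.
case: j => [//|j]; rewrite /inv_vtheta_pred_sq vthetaS_sq.
have h : 1 - vt j.+1 != 0.
  by rewrite gt_eqF// subr_gt0 (lt_le_trans (vtheta_ltS j))// vtheta_le1.
by field; rewrite h gt_eqF ?vtheta_gt0.
Qed.

Lemma inv_vtheta_pred_ge0 j : 0 <= inv j.
Proof. by rewrite inv_vtheta_predE divr_ge0 ?subr_ge0 ?vtheta_le1 ?exprn_ge0 ?ltW ?vtheta_gt0. Qed.

Lemma gammaSS j i : gam j.+2 i =
  if (i < j.+1)%N then (1 - vt j.+1) * gam j.+1 i
  else if i == j.+1 then
    vt j.+1 * (1 - th0^-1 * vt j) + th0^-1 * (vt j - vt j.+1)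
  else if i == j.+2 then th0^-1 * vt j.+1
  else 0.
Proof. by rewrite invf_div. Qed.

Lemma gamma_diagS j : gam j.+1 j.+1 = th0^-1 * vt j.
Proof.
case: j => [|j]; first by rewrite /= mulVf ?gt_eqF.
by rewrite gammaSS ltnNge leqnSn/= eqn_leq ltnn eqxx.
Qed.

Lemma gamma_ge0 j i : 0 <= gam j i.
Proof.
elim: j i => [|j IH] i; first by rewrite /=; case: eqP.
case: j IH => [|j] IH; first by rewrite /=; case: eqP.
have Nge0 : 0 <= th0^-1 by rewrite invr_ge0 ltW.
rewrite gammaSS.
case: ifP => _; first by rewrite mulr_ge0 ?IH// subr_ge0 vtheta_le1.
case: ifP => _.
  apply: addr_ge0.
    apply: mulr_ge0; first exact/ltW/vtheta_gt0.
    by rewrite subr_ge0 mulrC ler_pdivrMr ?mul1r ?vtheta_le.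
  by apply: mulr_ge0 => //; rewrite subr_ge0 ltW ?vtheta_ltS.
by case: ifP => // _; apply: mulr_ge0 => //; exact/ltW/vtheta_gt0.
Qed.

(** The rows of [gamma] are built to reproduce [x_(j+1) = (1 - theta_j) x_j + theta_j z_j + (n /
    tau) theta_j (z_(j+1) - z_j)]. An arbitrary module serves both the vectors [z_l] and, through
    [R^o], scalar sequences such as the values [psi z_l]. *)
Lemma gamma_recurrence (V : lmodType R) (c : nat -> V) j :
  \sum_(i < j.+2) gam j.+1 i *: c i =
  (1 - vt j) *: (\sum_(i < j.+1) gam j i *: c i)
  + (vt j - th0^-1 * vt j) *: c j + (th0^-1 * vt j) *: c j.+1.
Proof.
case: j => [|j].
  rewrite !big_ord_recr !big_ord0 /= !add0r scale0r add0r mulVf ?gt_eqF// !scale1r.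
  by rewrite -scalerDl (_ : 1 - _ + _ = 0) ?scale0r ?add0r//; ring.
transitivity (\sum_(i < j.+1) gam j.+2 i *: c i
    + gam j.+2 j.+1 *: c j.+1 + gam j.+2 j.+2 *: c j.+2).
  by rewrite 2!big_ord_recr.
have -> : \sum_(i < j.+2) gam j.+1 i *: c i =
    \sum_(i < j.+1) gam j.+1 i *: c i + gam j.+1 j.+1 *: c j.+1.
  by rewrite big_ord_recr.
have -> : \sum_(i < j.+1) gam j.+2 i *: c i =
    (1 - vt j.+1) *: (\sum_(i < j.+1) gam j.+1 i *: c i).
  by rewrite scaler_sumr; apply: eq_bigr => i _; rewrite scalerA gammaSS ltn_ord.
rewrite [gam j.+2 j.+2]gamma_diagS gamma_diagS gammaSS ltnn eqxx.
rewrite scalerDr -!addrA; congr (_ + _).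
rewrite [RHS]addrA scalerA -[in RHS]scalerDl; congr (_ *: _ + _).
by set N := th0^-1; ring.
Qed.

Lemma gamma_recurrenceR (c : nat -> R) j :
  \sum_(i < j.+2) gam j.+1 i * c i =
  (1 - vt j) * (\sum_(i < j.+1) gam j i * c i)
  + (vt j - th0^-1 * vt j) * c j + (th0^-1 * vt j) * c j.+1.
Proof. exact: (@gamma_recurrence R^o c j). Qed.

Lemma gamma_sum1 j : \sum_(i < j.+1) gam j i = 1.
Proof.
elim: j => [|j IH]; first by rewrite big_ord_recr big_ord0 /= add0r.
have := gamma_recurrenceR (fun=> 1) j.
under eq_bigr do rewrite mulr1.
under [in X in _ * X]eq_bigr do rewrite mulr1.
by rewrite IH => ->; ring.
Qed.

(** Hence [last_weight] is the diagonal coefficient [gam j j * inv j] minus [inv 0], the share which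
    is kept for the potential of the last point. *)
Lemma gamma_diag_inv j : gam j.+1 j.+1 * inv j.+1 = 1 / (vt 0 * vt j).
Proof.
rewrite gamma_diagS /inv_vtheta_pred_sq -/(vt 0).
have := vtheta_gt0 j; have := vtheta_gt0 0.
rewrite -[th0]/(vt 0); set a := vt 0; set b := vt j => a0 b0.
by field; rewrite !gt_eqF.
Qed.

Lemma WsumE j : Wsum n tau j.+1 = \sum_(i < j.+2) gam j.+1 i * inv i - inv 0.
Proof. by rewrite /Wsum /last_weight [in RHS]big_ord_recr -gamma_diag_inv /= addrA. Qed.

Lemma last_weight_gt0 j : 0 < last_weight n tau j.
Proof.
rewrite /last_weight.
have a0 := vtheta_gt0 0; have b0 := vtheta_gt0 j.-1.
have ba : vt j.-1 <= vt 0 := vtheta_le j.-1.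
move: (vt 0) (vt j.-1) a0 b0 ba => a b a0 b0 ba.
have -> : 1 / (a * b) - (1 - a) / a ^+ 2 = (a - b + a * b) / (a ^+ 2 * b).
  by field; rewrite !gt_eqF.
by rewrite divr_gt0// ?mulr_gt0 ?exprn_gt0// ltr_wpDl ?subr_ge0 ?mulr_gt0.
Qed.

Lemma Wsum_gt0 j : 0 < Wsum n tau j.
Proof.
rewrite /Wsum ltr_wpDl ?last_weight_gt0//.
by apply: sumr_ge0 => i _; rewrite mulr_ge0 ?gamma_ge0 ?inv_vtheta_pred_ge0.
Qed.

(** For consecutive inverses [A], [B] the recursion reads [A^2 = B^2 - B = (B - 1/2)^2 - 1/4], so
    [A < B - 1/2]: each step adds at least one half. *)
Lemma inv_vtheta_ge j : th0^-1 + j%:R / 2 <= (vt j)^-1.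
Proof.
elim: j => [|j IH]; first by rewrite mul0r addr0.
have a0 := vtheta_gt0 j; have b0 := vtheta_gt0 j.+1.
have E : (vt j)^-1 ^+ 2 = (vt j.+1)^-1 ^+ 2 - (vt j.+1)^-1.
  have b1 : vt j.+1 < 1 by rewrite (lt_le_trans (vtheta_ltS j))// vtheta_le1.
  have := vthetaS_sq j; move: (vt j.+1) (vt j) a0 b0 b1 => b a a0 b0 b1 e.
  have -> : a^-1 ^+ 2 = (1 - b) / b ^+ 2.
    by rewrite e; field; rewrite !gt_eqF ?subr_gt0.
  by field; rewrite gt_eqF.
have ai : 0 < (vt j)^-1 by rewrite invr_gt0.
have bi : 0 < (vt j.+1)^-1 by rewrite invr_gt0.
have bi1 : 1 < (vt j.+1)^-1.
  by rewrite invf_gt1// (lt_le_trans (vtheta_ltS j))// vtheta_le1.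
have : (vt j)^-1 + 1 / 2 <= (vt j.+1)^-1.
  move: (vt j)^-1 (vt j.+1)^-1 E ai bi bi1 => A B E A0 B0 B1.
  rewrite leNgt; apply/negP => h.
  have : 0 < (A + 1 / 2 - B) * (A + B - 1 / 2) by apply: mulr_gt0; lra.
  by nra.
by rewrite -(natr1 j); lra.
Qed.

(* With [a_i = 1 / vtheta_i], the product [Q_k a_(k-1)^2] grows by
   [a_k^3 + (1/theta_0 - 1) a_k^2] at each step, and [2 a_k^3 - a_k^2] is
   exactly the increment of [a^4]. *)
Lemma Wsum_ge j : 6 * th0^-1 ^+ 2 <= (vt j)^-1 ^+ 2 ->
  (vt j)^-1 ^+ 2 / 3 <= Wsum n tau j.+1.
Proof.
have Q_ge k : (th0^-1 ^+ 4 + (vt k)^-1 ^+ 4) / 2 <=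
    (\sum_(i < k.+2) gam k.+1 i * inv i) * (vt k)^-1 ^+ 2.
  elim: k => [|k IH].
    rewrite gamma_recurrenceR big_ord1.
    have g0 : gam 0 ord0 = 1 by [].
    have E1 : inv 1 = 1 / vt 0 ^+ 2 by [].
    rewrite g0 E1 !(inv_vtheta_predE 0).
    rewrite le_eqVlt; apply/orP; left; apply/eqP.
    by rewrite vtheta0; move: th0 th0_gt0 => t t0; field; rewrite gt_eqF.
  rewrite gamma_recurrenceR {2}/inv_vtheta_pred_sq {2}/inv_vtheta_pred_sq.
  have a0 := vtheta_gt0 k; have b0 := vtheta_gt0 k.+1.
  have b1 : vt k.+1 < 1 by rewrite (lt_le_trans (vtheta_ltS k))// vtheta_le1.
  have N1 : 1 <= th0^-1 by rewrite invf_ge1.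
  have := vthetaS_sq k; move: IH.
  set Q := \sum_(i < _) _; move: (vt k.+1) (vt k) a0 b0 b1 N1 => b a a0 b0 b1.
  move: th0^-1 => N N1 IH e.
  have eA : a^-1 ^+ 2 = b^-1 ^+ 2 - b^-1.
    have -> : a^-1 ^+ 2 = (1 - b) / b ^+ 2.
      by rewrite e; field; rewrite !gt_eqF ?subr_gt0.
    by field; rewrite gt_eqF.
  rewrite !div1r -!exprVn.
  have B1 : 1 < b^-1 by rewrite invf_gt1.
  have -> : ((1 - b) * Q + (b - N * b) * a^-1 ^+ 2 + N * b * b^-1 ^+ 2) * b^-1 ^+ 2
     = Q * a^-1 ^+ 2 + b^-1 ^+ 3 + (N - 1) * b^-1 ^+ 2.
    by rewrite eA; field; rewrite gt_eqF.
  have e4 : a^-1 ^+ 4 = (b^-1 ^+ 2 - b^-1) ^+ 2 by rewrite -eA -exprM.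
  move: IH; rewrite e4.
  move: (Q * _) b^-1 B1 => Q' B B1.
  have : 0 <= (N - 1) * B ^+ 2 by rewrite mulr_ge0 ?exprn_ge0 ?subr_ge0 // ltW// (lt_trans ltr01).
  have : 0 <= B ^+ 2 by rewrite exprn_ge0// ltW// (lt_trans ltr01).
  by nra.
move=> h6; rewrite WsumE.
have := Q_ge j; set Q := \sum_(i < _) _ => hQ.
have N1 : 1 <= th0^-1 by rewrite invf_ge1.
have E0 : inv 0 = th0^-1 ^+ 2 - th0^-1.
  by rewrite inv_vtheta_predE vtheta0; move: th0 th0_gt0 => t t0; field; rewrite gt_eqF.
rewrite E0; have A0 : 0 < (vt j)^-1 by rewrite invr_gt0 vtheta_gt0.
have N4 : 0 <= th0^-1 ^+ 4 by rewrite exprn_ge0// ltW// (lt_le_trans ltr01).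
(* Drop [th0^-1 ^+ 4] and divide by [a^2], where [a = (vt j)^-1]. Subtracting [inv 0], which is at
   most [th0^-1 ^+ 2 <= a^2 / 6], then leaves [1/2 - 1/6 = 1/3]. *)
have : (vt j)^-1 ^+ 2 / 2 <= Q.
  rewrite -(@ler_pM2r _ ((vt j)^-1 ^+ 2)) ?exprn_gt0//.
  by apply: le_trans hQ; nra.
by lra.
Qed.

End Coefficients.

(** * Convexity *)

Lemma convex_combination_ind (R : realFieldType) (V : lmodType R)
    (C : V -> Prop) (G : V -> R) :
  (forall a b t, C a -> C b -> 0 <= t <= 1 ->
     C (t *: a + (1 - t) *: b) /\
     G (t *: a + (1 - t) *: b) <= t * G a + (1 - t) * G b) ->
  forall m (c : nat -> R) (p : nat -> V),
    (forall i, (i < m)%N -> 0 <= c i) -> (forall i, (i < m)%N -> C (p i)) ->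
    0 < \sum_(i < m) c i ->
    C ((\sum_(i < m) c i)^-1 *: \sum_(i < m) c i *: p i) /\
    (\sum_(i < m) c i) * G ((\sum_(i < m) c i)^-1 *: \sum_(i < m) c i *: p i)
      <= \sum_(i < m) c i * G (p i).
Proof.
move=> conv; elim=> [|m IH] c p c0 Cp; first by rewrite big_ord0 ltxx.
rewrite !big_ord_recr/=; set s := \sum_(i < m) c i; set u := \sum_(i < m) _ *: _.
have IH' := IH c p (fun i h => c0 i (ltnW h)) (fun i h => Cp i (ltnW h)).
have s0 : 0 <= s by apply: sumr_ge0 => i _; apply/c0/ltnW/ltn_ord.
have cm0 := c0 m (ltnSn m); have Cm := Cp m (ltnSn m).
move: s0; rewrite le_eqVlt => /orP[/eqP s0|s0].
  have cz (i : 'I_m) : c i = 0.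
    move/esym/psumr_eq0P : s0 => /(_ (fun i _ => c0 i (ltnW (ltn_ord i)))).
    exact.
  have -> : u = 0 by apply: big1 => i _; rewrite cz scale0r.
  have -> : \sum_(i < m) c i * G (p i) = 0 by apply: big1 => i _; rewrite cz mul0r.
  by rewrite -s0 !add0r => cm; rewrite scalerA mulVf ?gt_eqF// scale1r.
have [Cu Gu] := IH' s0; move=> sc0.
have t01 : 0 <= s / (s + c m) <= 1.
  apply/andP; split; first by rewrite divr_ge0// ltW.
  by rewrite ler_pdivrMr// mul1r lerDl.
have [] := conv _ _ _ Cu Cm t01.
have -> : s / (s + c m) *: (s^-1 *: u) + (1 - s / (s + c m)) *: p m
   = (s + c m)^-1 *: (u + c m *: p m).
  rewrite scalerA scalerDr scalerA; congr (_ *: _ + _ *: _).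
    by field; rewrite !gt_eqF.
  by field; rewrite gt_eqF.
move=> Cs Gs; split=> //.
have := ler_wpM2l (ltW sc0) Gs.
have -> : (s + c m) * (s / (s + c m) * G (s^-1 *: u) + (1 - s / (s + c m)) * G (p m))
  = s * G (s^-1 *: u) + c m * G (p m).
  by field; rewrite gt_eqF.
by move=> h; apply: le_trans h _; rewrite lerD2r.
Qed.

Lemma jensen (R : realFieldType) (V : lmodType R)
    (C : V -> Prop) (G : V -> R) :
  (forall a b t, C a -> C b -> 0 <= t <= 1 ->
     C (t *: a + (1 - t) *: b) /\
     G (t *: a + (1 - t) *: b) <= t * G a + (1 - t) * G b) ->
  forall m (c : nat -> R) (p : nat -> V),
    (forall i, (i < m)%N -> 0 <= c i) -> (forall i, (i < m)%N -> C (p i)) ->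
    \sum_(i < m) c i = 1 ->
    C (\sum_(i < m) c i *: p i) /\
    G (\sum_(i < m) c i *: p i) <= \sum_(i < m) c i * G (p i).
Proof.
move=> conv m c p c0 Cp c1.
have := convex_combination_ind conv c0 Cp; rewrite c1 invr1 scale1r mul1r.
by apply.
Qed.

Lemma convex_functionP (R : realType) (V : lmodType R) (f : V -> R) (a b : V) (t : R) :
  @convex_function R V setT f -> 0 <= t <= 1 ->
  f (t *: a + (1 - t) *: b) <= t * f a + (1 - t) * f b.
Proof.
move=> fc /andP[t0 t1].
by have := fc (Itv01 t0 t1) a b; rewrite !in_setT => /(_ isT isT).
Qed.

(** By convexity the difference quotients along [y - x] with step in [(0, 1]] are at most
    [f y - f x], and so is their limit from the right. Linearity of the differential expresses this
    limit by partial derivatives. *)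
Lemma convex_gradient_le (R : realType) (n : nat) (f : 'rV[R]_n -> R)
    (x y : 'rV[R]_n) :
  @convex_function R 'rV[R]_n setT f -> differentiable f x ->
  f x + \sum_(i < n) partial f i x * (y - x) 0 i <= f y.
Proof.
move=> fc fd.
have <- : 'D_(y - x) f x = \sum_(i < n) partial f i x * (y - x) 0 i.
  rewrite deriveE// {1}(row_sum_delta (y - x)) linear_sum.
  by apply: eq_bigr => i _; rewrite linearZ/= /partial deriveE// mulrC.
rewrite -lerBrDl.
apply: (@cvgr_to_le _ (0^'+) _ _ (fun h => h^-1 *: ((f \o shift x) (h *: (y - x)) - f x))).
  exact/cvg_dnbhs_at_right/(diff_derivable (v := y - x) fd).
near=> h.
have h0 : 0 < h by near: h; exact: nbhs_right_gt.
have h1 : h <= 1 by near: h; exact: nbhs_right_le.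
rewrite /= -[_ *: _]/(_ * _) ler_pdivrMl// mulrBr lerBlDr.
have h01 : 0 <= h <= 1 by rewrite ltW.
have := convex_functionP y x fc h01.
have -> : h *: y + (1 - h) *: x = h *: (y - x) + x.
  by rewrite scalerBr scalerBl scale1r addrCA addrC -addrA addrC -addrA [- _ + _]addrC.
by move/le_trans; apply; rewrite mulrBl mul1r; lra.
Unshelve. all: by end_near.
Qed.

(** * Proximal points in one variable *)

Section Prox.
Context (R : realType) (g : R -> \bar R).
Hypothesis g_cc : closed_convex g.

Lemma closed_convex_fin_num (t : R) : (g t \is a fin_num) = (g t < +oo)%E.
Proof. by case: g_cc => h _ _; rewrite ltey_eq (negbTE (h t)) orbF. Qed.

Lemma closed_convex_fine (a b t : R) : g a \is a fin_num -> g b \is a fin_num ->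
  0 <= t <= 1 ->
  g (t * a + (1 - t) * b) \is a fin_num /\
  fine (g (t * a + (1 - t) * b)) <= t * fine (g a) + (1 - t) * fine (g b).
Proof.
move=> ga gb /andP[t0 t1]; case: g_cc => _ _ /(_ a b t t0 t1).
rewrite -(fineK ga) -(fineK gb) -!EFinM -EFinD => h.
have gf : g (t * a + (1 - t) * b) \is a fin_num.
  by rewrite closed_convex_fin_num (le_lt_trans h)// ltry.
by split=> //; move: h; rewrite -{1}(fineK gf) lee_fin.
Qed.

Context (a c y z : R).
Hypothesis c_ge0 : 0 <= c.
Let phi (t : R) : \bar R := ((a * (t - y) + c * `|t - z| ^+ 2)%:E + g t)%E.

Lemma prox_fin_num (u t : R) : is_minimizer phi u -> g t \is a fin_num ->
  g u \is a fin_num.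
Proof.
move=> /(_ t) h gt; rewrite closed_convex_fin_num.
move: h; rewrite /phi -(fineK gt) -EFinD.
by case: (g u) => [r| |]; rewrite ?ltry.
Qed.

(** Compare [u] with the point [l * t + (1 - l) * u] and divide by [l]: the quadratic term yields
    the claim up to the error [l * D], where [D = c * (t - u) ^+ 2]. *)
Lemma prox_three_points (u t : R) : is_minimizer phi u -> g t \is a fin_num ->
  a * (u - y) + c * (u - z) ^+ 2 + fine (g u) + c * (t - u) ^+ 2
    <= a * (t - y) + c * (t - z) ^+ 2 + fine (g t).
Proof.
move=> umin gt; have gu := prox_fin_num umin gt.
apply/ler_addgt0Pr => e e0.
pose D := c * (t - u) ^+ 2; have D0 : 0 <= D by rewrite mulr_ge0 ?sqr_ge0.
(* Any [l] in [(0, 1]] with [D * l <= e] would do; an explicit one replaces the limit [l -> 0], and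
   it is defined even if [D = 0]. *)
pose l := e / (e + D).
have eD : 0 < e + D by rewrite ltr_wpDr.
have l0 : 0 < l by rewrite divr_gt0.
have l1 : l <= 1 by rewrite ler_pdivrMr// mul1r lerDl.
have lD : D * l <= e.
  by rewrite /l mulrCA ger_pMr// ler_pdivrMr// mul1r lerDr ltW.
have l01 : 0 <= l <= 1 by rewrite ltW.
have [gv gvle] := closed_convex_fine gt gu l01.
have := umin (l * t + (1 - l) * u).
rewrite /phi -(fineK gu) -(fineK gv) -!EFinD lee_fin !real_normK ?num_real// => h.
have {}h := le_trans h (lerD (lexx _) gvle).
rewrite -/D -(@ler_pM2l _ l)//.
have E : c * (l * t + (1 - l) * u - z) ^+ 2
    = l * (c * (t - z) ^+ 2) + (1 - l) * (c * (u - z) ^+ 2) - l * (1 - l) * D.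
  by rewrite /D; ring.
rewrite E in h.
have : l * (D * l) <= l * e by rewrite ler_pM2l.
by lra.
Qed.

(** The three-point inequality used in both directions gives [2 * c * (u - u') ^+ 2 <= 0]. *)
Lemma prox_unique (u u' t : R) : 0 < c -> is_minimizer phi u ->
  is_minimizer phi u' -> g t \is a fin_num -> u = u'.
Proof.
move=> c0 um um' gt.
have gu := prox_fin_num um gt; have gu' := prox_fin_num um' gt.
have h := prox_three_points um gu'; have h' := prox_three_points um' gu.
have : c * (u - u') ^+ 2 <= 0.
  have e : (u' - u) ^+ 2 = (u - u') ^+ 2 by ring.
  by move: h; rewrite e; lra.
rewrite pmulr_rle0// => h2; apply/eqP; rewrite -subr_eq0 -sqrf_eq0 eq_le h2.
exact: sqr_ge0.
Qed.

End Prox.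

(** * One accelerated step *)

Section Objective.
Context (R : realType) (n : nat) (f : 'rV[R]_n -> R) (psi : 'I_n -> R -> \bar R).

Definition finite_at (x : 'rV[R]_n) : Prop := forall i, psi i (x 0 i) \is a fin_num.

Definition separable_fine (x : 'rV[R]_n) : R := \sum_(i < n) fine (psi i (x 0 i)).

Definition objective_fine (x : 'rV[R]_n) : R := f x + separable_fine x.

Lemma objective_fineE x : finite_at x -> objective f psi x = (objective_fine x)%:E.
Proof.
move=> fx; rewrite /objective /separable EFinD -sumEFin; congr (_ + _)%E.
by apply: eq_bigr => i _; rewrite fineK.
Qed.

Hypothesis psi_cc : forall i, closed_convex (psi i).

Lemma finite_at_ltyP x : (separable psi x < +oo)%E -> finite_at x.
Proof.
rewrite ltey => /eqP h i; rewrite closed_convex_fin_num// ltey; apply/eqP => pi.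
apply: h; apply/esum_eqyP => [j _|]; last by exists i.
by case: (psi_cc j) => /(_ (x 0 j)).
Qed.

Lemma separable_fine_convex a b t : finite_at a -> finite_at b -> 0 <= t <= 1 ->
  finite_at (t *: a + (1 - t) *: b) /\
  separable_fine (t *: a + (1 - t) *: b)
    <= t * separable_fine a + (1 - t) * separable_fine b.
Proof.
move=> fa fb t01.
have H i := closed_convex_fine (psi_cc i) (fa i) (fb i) t01.
split=> [i|]; first by rewrite !mxE; case: (H i).
rewrite /separable_fine !mulr_sumr -big_split/=; apply: ler_sum => i _.
by rewrite !mxE; case: (H i).
Qed.

Hypothesis f_convex : @convex_function R 'rV[R]_n setT f.

Lemma objective_fine_convex a b t : finite_at a -> finite_at b -> 0 <= t <= 1 ->
  finite_at (t *: a + (1 - t) *: b) /\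
  objective_fine (t *: a + (1 - t) *: b)
    <= t * objective_fine a + (1 - t) * objective_fine b.
Proof.
move=> fa fb t01; have [? h] := separable_fine_convex fa fb t01; split=> //.
have := convex_functionP a b f_convex t01; rewrite /objective_fine.
by move: h; lra.
Qed.

End Objective.

Lemma wnorm2_convex (R : realType) (n : nat) (v : 'I_n -> R) (xs a b : 'rV[R]_n) (t : R) :
  (forall i, 0 <= v i) -> 0 <= t <= 1 ->
  wnorm2 v (t *: a + (1 - t) *: b - xs)
    <= t * wnorm2 v (a - xs) + (1 - t) * wnorm2 v (b - xs).
Proof.
move=> v0 /andP[t0 t1]; rewrite /wnorm2 !mulr_sumr -big_split/=.
apply: ler_sum => i _; rewrite !mxE.
have : 0 <= v i * (t * (1 - t) * (a 0 i - b 0 i) ^+ 2).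
  by rewrite mulr_ge0// mulr_ge0 ?sqr_ge0// mulr_ge0// subr_ge0.
move: (a 0 i) (b 0 i) (xs 0 i) (v i) => A B X V h.
rewrite -subr_ge0; apply: le_trans h _.
by rewrite le_eqVlt; apply/orP; left; apply/eqP; ring.
Qed.

Lemma wnorm2_ge0 (R : realType) (n : nat) (v : 'I_n -> R) (x : 'rV[R]_n) :
  (forall i, 0 <= v i) -> 0 <= wnorm2 v x.
Proof. by move=> v0; apply: sumr_ge0 => i _; rewrite mulr_ge0 ?sqr_ge0. Qed.

Section Step.
Context (R : realType) (n : nat) (f : 'rV[R]_n -> R) (psi : 'I_n -> R -> \bar R).
Hypothesis f_convex : @convex_function R 'rV[R]_n setT f.
Hypothesis f_diff : forall x : 'rV[R]_n, differentiable f x.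
Hypothesis psi_cc : forall i : 'I_n, closed_convex (psi i).
Context (v : 'I_n -> R) (tau : R) (xs : 'rV[R]_n).
Hypothesis v_gt0 : forall i, 0 < v i.
Hypothesis xs_fin : finite_at psi xs.
Local Notation th0 := (tau / n%:R).
Hypothesis th0_gt0 : 0 < th0.
Context (pr : {set 'I_n} -> R).
Hypothesis pr_sum : \sum_A pr A = 1.
Hypothesis pr_marginal : forall i, \sum_(A : {set 'I_n} | i \in A) pr A = th0.
Hypothesis eso : forall x h : 'rV[R]_n,
  \sum_A pr A * f (x + restrict_to A h)
    <= f x + th0 * (\sum_(i < n) partial f i x * h 0 i + 1 / 2 * wnorm2 v h).

Definition block_update (z u : 'rV[R]_n) (A : {set 'I_n}) : 'rV[R]_n :=
  \row_i (if i \in A then u 0 i else z 0 i).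

Lemma restrict_toE (A : {set 'I_n}) (h : 'rV[R]_n) i :
  restrict_to A h 0 i = if i \in A then h 0 i else 0.
Proof.
rewrite /restrict_to summxE; case: ifP => iA.
  rewrite (bigD1 i)//= !mxE !eqxx mulr1 big1 ?addr0// => j /andP[_ ji].
  by rewrite !mxE (eq_sym i) (negbTE ji) andbF mulr0.
rewrite big1// => j jA; rewrite !mxE (_ : i == j = false) ?andbF ?mulr0//.
by apply/eqP => ij; rewrite -ij iA in jA.
Qed.

(** Each summand sees only whether its own coordinate is drawn, so the marginals determine the mean,
    whatever the joint law of the sampling. *)
Lemma expected_block_update (phi : 'I_n -> R -> R) (z u : 'rV[R]_n) :
  \sum_A pr A * (\sum_(i < n) phi i (block_update z u A 0 i))
  = (1 - th0) * (\sum_(i < n) phi i (z 0 i)) + th0 * (\sum_(i < n) phi i (u 0 i)).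
Proof.
under eq_bigr do rewrite mulr_sumr.
rewrite exchange_big/= !mulr_sumr -big_split/=; apply: eq_bigr => i _.
rewrite (bigID (fun A : {set 'I_n} => i \in A))/=.
under eq_bigr => A iA do rewrite !mxE iA.
rewrite addrC.
under eq_bigr => A iA do rewrite !mxE (negbTE iA).
rewrite -!mulr_suml pr_marginal; congr (_ * _ + _).
rewrite -(pr_marginal i) -pr_sum.
by rewrite [in RHS](bigID (fun A : {set 'I_n} => i \in A))/= addrAC subrr add0r.
Qed.

(** Here [u] is the proximal point in all coordinates, and [ph] stands for the surrogate of [psi x].
    The ESO is applied to [h = (t / th0) (u - z)], whose restriction to the sampled blocks is the
    actual move. Since [y = (1 - t) x + t z], one has [t (u - z) = t (u - y) + (1 - t) (x - y)],
    which splits the linear term into [Gu] and [Gx]. *)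
Lemma accelerated_step (x z y u : 'rV[R]_n) (t ph : R) :
  0 < t -> t <= 1 -> y = (1 - t) *: x + t *: z -> finite_at psi z ->
  (forall i, is_minimizer
     (fun s : R => ((partial f i y * (s - y 0 i)
        + t * n%:R * v i / (2 * tau) * `|s - z 0 i| ^+ 2)%:E + psi i s)%E)
     (u 0 i)) ->
  \sum_A pr A * (f (y + (n%:R / tau * t) *: (block_update z u A - z))
      + ((1 - t) * ph + (t - th0^-1 * t) * separable_fine psi z
         + th0^-1 * t * separable_fine psi (block_update z u A))
      - objective_fine f psi xs
      + t ^+ 2 / (2 * th0 ^+ 2) * wnorm2 v (block_update z u A - xs))
  <= (1 - t) * (f x + ph - objective_fine f psi xs)
     + t ^+ 2 / (2 * th0 ^+ 2) * wnorm2 v (z - xs).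
Proof.
move=> t0 t1 yE z_fin umin.
have -> : n%:R / tau = th0^-1 by rewrite invf_div.
have Ef : \sum_A pr A * f (y + (th0^-1 * t) *: (block_update z u A - z))
    <= f y + th0 * (\sum_(i < n) partial f i y * ((th0^-1 * t) *: (u - z)) 0 i
                    + 1 / 2 * wnorm2 v ((th0^-1 * t) *: (u - z))).
  apply: le_trans (eso y ((th0^-1 * t) *: (u - z))).
  rewrite le_eqVlt; apply/orP; left; apply/eqP; apply: eq_bigr => A _.
  congr (_ * f (_ + _)); apply/rowP => i; rewrite restrict_toE !mxE.
  by case: ifP => // _; rewrite subrr mulr0.
have EPsi := expected_block_update (fun i s => fine (psi i s)) z u.
have wE w : wnorm2 v (w - xs) = \sum_(i < n) v i * (w 0 i - xs 0 i) ^+ 2.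
  by apply: eq_bigr => i _; rewrite !mxE.
have EN := expected_block_update (fun i s => v i * (s - xs 0 i) ^+ 2) z u.
have [tz nz] : tau != 0 /\ n%:R != 0 :> R.
  by apply/andP; have := lt0r_neq0 th0_gt0; rewrite mulf_eq0 invr_eq0 negb_or.
have prox : \sum_(i < n) partial f i y * (u 0 i - y 0 i)
      + t / (2 * th0) * (\sum_(i < n) v i * (u 0 i - z 0 i) ^+ 2)
      + separable_fine psi u + t / (2 * th0) * (\sum_(i < n) v i * (u 0 i - xs 0 i) ^+ 2)
    <= \sum_(i < n) partial f i y * (xs 0 i - y 0 i)
      + t / (2 * th0) * (\sum_(i < n) v i * (z 0 i - xs 0 i) ^+ 2)
      + separable_fine psi xs.
  rewrite !mulr_sumr -!big_split/=; apply: ler_sum => i _.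
  have ci : 0 <= t * n%:R * v i / (2 * tau).
    have -> : t * n%:R * v i / (2 * tau) = t * v i / (2 * th0).
      by field; rewrite nz tz.
    by apply/ltW/divr_gt0; apply: mulr_gt0.
  have := prox_three_points (psi_cc i) ci (umin i) (xs_fin i).
  have -> : t * n%:R * v i / (2 * tau) = t / (2 * th0) * v i.
    by field; rewrite nz tz.
  rewrite -!mulrA.
  have -> : (xs 0 i - u 0 i) ^+ 2 = (u 0 i - xs 0 i) ^+ 2 by ring.
  by have -> : (xs 0 i - z 0 i) ^+ 2 = (z 0 i - xs 0 i) ^+ 2 by ring.
have gx := convex_gradient_le x f_convex (f_diff y).
have gs := convex_gradient_le xs f_convex (f_diff y).
have e1 w : \sum_(i < n) partial f i y * (w - y) 0 i =
    \sum_(i < n) partial f i y * (w 0 i - y 0 i).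
  by apply: eq_bigr => i _; rewrite !mxE.
rewrite !e1 in gx gs.
have e2 : \sum_(i < n) partial f i y * ((th0^-1 * t) *: (u - z)) 0 i =
    th0^-1 * (t * (\sum_(i < n) partial f i y * (u 0 i - y 0 i))
      + (1 - t) * (\sum_(i < n) partial f i y * (x 0 i - y 0 i))).
  rewrite !mulr_sumr -big_split mulr_sumr/=; apply: eq_bigr => i _.
  by rewrite yE !mxE; ring.
have e3 : wnorm2 v ((th0^-1 * t) *: (u - z)) =
    (th0^-1 * t) ^+ 2 * (\sum_(i < n) v i * (u 0 i - z 0 i) ^+ 2).
  by rewrite mulr_sumr; apply: eq_bigr => i _; rewrite !mxE; ring.
rewrite e2 e3 in Ef.
have -> : \sum_A pr A * (f (y + (th0^-1 * t) *: (block_update z u A - z))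
      + ((1 - t) * ph + (t - th0^-1 * t) * separable_fine psi z
         + th0^-1 * t * separable_fine psi (block_update z u A))
      - objective_fine f psi xs
      + t ^+ 2 / (2 * th0 ^+ 2) * wnorm2 v (block_update z u A - xs))
  = \sum_A pr A * f (y + (th0^-1 * t) *: (block_update z u A - z))
    + ((1 - t) * ph + (t - th0^-1 * t) * separable_fine psi z - objective_fine f psi xs)
    + th0^-1 * t * (\sum_A pr A * separable_fine psi (block_update z u A))
    + t ^+ 2 / (2 * th0 ^+ 2) * (\sum_A pr A * wnorm2 v (block_update z u A - xs)).
  rewrite -[X in _ + X + _ + _]mul1r -pr_sum mulr_suml !mulr_sumr -!big_split/=.
  by apply: eq_bigr => A _; ring.
rewrite [\sum_A pr A * separable_fine psi _]EPsi.
under [\sum_A pr A * wnorm2 v _]eq_bigr do rewrite wE.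
rewrite EN wE -/(separable_fine psi z) -/(separable_fine psi u) /objective_fine.
move: prox gx gs Ef.
set E := \sum_A pr A * f (y + (th0^-1 * t) *: (block_update z u A - z)).
set Gu := \sum_(i < n) partial f i y * (u 0 i - y 0 i).
set Gs := \sum_(i < n) partial f i y * (xs 0 i - y 0 i).
set Gx := \sum_(i < n) partial f i y * (x 0 i - y 0 i).
set Nuz := \sum_(i < n) v i * (u 0 i - z 0 i) ^+ 2.
set Nus := \sum_(i < n) v i * (u 0 i - xs 0 i) ^+ 2.
set Nzs := \sum_(i < n) v i * (z 0 i - xs 0 i) ^+ 2.
move: E Gu Gs Gx Nuz Nus Nzs (separable_fine psi u) (separable_fine psi z)
  (separable_fine psi xs) (f x) (f y) (f xs).
move: th0 th0_gt0 => h h0 E Gu Gs Gx Nuz Nus Nzs Pu Pz Ps fx fy fs prox gx gs Ef.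
(* All occurrences of [Pz] cancel: the coordinates left unsampled contribute
   [h^-1 * t * (1 - h) * Pz], which offsets the weight [t - h^-1 * t]. *)
have -> : E + ((1 - t) * ph + (t - h^-1 * t) * Pz - (fs + Ps))
    + h^-1 * t * ((1 - h) * Pz + h * Pu)
    + t ^+ 2 / (2 * h ^+ 2) * ((1 - h) * Nzs + h * Nus)
  = E + (1 - t) * ph + t * Pu - (fs + Ps) + t ^+ 2 / (2 * h ^+ 2) * Nzs
    + t * (t / (2 * h) * (Nus - Nzs)).
  by field; rewrite gt_eqF.
have {}Ef : E <= fy + t * Gu + (1 - t) * Gx + t * (t / (2 * h) * Nuz).
  apply: le_trans Ef _; rewrite le_eqVlt; apply/orP; left; apply/eqP.
  by field; rewrite gt_eqF.
(* The quadratic term of the ESO is exactly [t] times the proximal one, so [t] times the three-point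
   inequality removes [Gu] and [Nuz] together. The gradient inequalities, weighted by [t] at [xs]
   and by [1 - t] at [x], remove [Gs] and [Gx]. *)
have {}prox := ler_wpM2l (ltW t0) prox.
have {}gs := ler_wpM2l (ltW t0) gs.
have {}gx : (1 - t) * (fy + Gx) <= (1 - t) * fx by rewrite ler_wpM2l ?subr_ge0.
by lra.
Qed.
End Step.

(** * Expectations over finite histories *)

Section FiniteExpectation.
Context d (T : measurableType d) (R : realType) (P : probability T R) (U : finType).

Lemma integral_finite_map (X : T -> U) (g : U -> R) : discrete_measurable_map X ->
  (\int[P]_w (g (X w))%:E = (\sum_u fine (P (X @^-1` [set u])) * g u)%:E)%E.
Proof.
move=> mX.
have -> : (\int[P]_w (g (X w))%:E
    = \int[P]_w (\sum_(u : U) (g u)%:E * (\1_(X @^-1` [set u]) w)%:E))%E.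
  apply: eq_integral => w _; rewrite (bigD1 (X w))//= indicE mem_set// mule1.
  rewrite big1 ?adde0// => u uX; rewrite indicE memNset ?mule0//=.
  by move=> e; rewrite e eqxx in uX.
rewrite integral_sum//; last first.
  by move=> u; apply: integrableZl => //; apply: integrable_indic.
rewrite -sumEFin; apply: eq_bigr => u _.
rewrite integralZl//; last exact: integrable_indic.
rewrite integral_indic// setIT EFinM fineK ?fin_num_measure//.
by rewrite muleC.
Qed.

End FiniteExpectation.

Section Histories.
Context d (T : measurableType d) (R : realType) (P : probability T R) (U : finType).
Context (S : nat -> T -> U) (pr : U -> R) (w0 : T).
Hypothesis S_meas : forall k, discrete_measurable_map (S k).
Hypothesis S_pr : forall k u, P (S k @^-1` [set u]) = (pr u)%:E.
Hypothesis S_indep : mutually_independent P S.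

Fixpoint hist_type (k : nat) : finType :=
  if k is k'.+1 then (hist_type k' * U)%type else unit.

Fixpoint hist (k : nat) (w : T) : hist_type k :=
  if k is k'.+1 return hist_type k then (hist k' w, S k' w) else tt.

Fixpoint hist_weight (k : nat) : hist_type k -> R :=
  if k is k'.+1 return hist_type k -> R
  then fun h => hist_weight h.1 * pr h.2 else fun=> 1.

Fixpoint hist_at (k : nat) : hist_type k -> nat -> set U :=
  if k is k'.+1 return hist_type k -> nat -> set U
  then fun h j => if j == k' then [set h.2] else hist_at h.1 j
  else fun _ _ => setT.

Lemma hist_eqP k (h : hist_type k) w :
  hist k w = h <-> forall j, (j < k)%N -> hist_at h j (S j w).
Proof.
elim: k h => [|k IH]; first by case.
case=> h u /=; split.
  move=> [hh uu] j; rewrite ltnS leq_eqVlt; case: eqP => [->//|_ /= jk].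
  exact: (IH h).1.
move=> H; congr pair; last by have := H k (ltnSn k); rewrite eqxx.
apply/IH => j jk; have := H j (ltnW jk).
by rewrite (ltn_eqF jk).
Qed.

Lemma hist_prob k (h : hist_type k) : P (hist k @^-1` [set h]) = (hist_weight h)%:E.
Proof.
have -> : hist k @^-1` [set h] = \bigcap_(j in [set` iota 0 k]) (S j @^-1` hist_at h j).
  apply/seteqP; split=> w /=.
    by move/hist_eqP => H j /=; rewrite mem_iota add0n => /H.
  by move=> H; apply/hist_eqP => j jk; apply: H => /=; rewrite mem_iota.
rewrite S_indep ?iota_uniq//.
elim: k h => [|k IH]; first by move=> h; rewrite big_nil.
case=> h u; have -> : iota 0 k.+1 = iota 0 k ++ [:: k] by rewrite -addn1 iotaD.
rewrite big_cat big_seq1/= eqxx S_pr EFinM.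
congr (_ * _)%E; rewrite -IH big_seq [RHS]big_seq; apply: eq_bigr => j.
by rewrite mem_iota add0n => /ltn_eqF ->.
Qed.

Lemma hist_measurable k : discrete_measurable_map (hist k).
Proof.
elim: k => [|k IH] B.
  have [Bt|Bt] := pselect (B tt).
    by rewrite (_ : _ @^-1` _ = setT)//; apply/seteqP; split.
  by rewrite (_ : _ @^-1` _ = set0)//; apply/seteqP; split.
have -> : hist k.+1 @^-1` B = \bigcup_(u in [set: U])
    (S k @^-1` [set u] `&` hist k @^-1` [set h | B (h, u)]).
  apply/seteqP; split=> w /=; first by move=> Bw; exists (S k w).
  by move=> [u _ [/= <-]].
apply: fin_bigcup_measurable => [|u _]; first exact: finite_finset.
by apply: measurableI; [exact: S_meas|exact: IH].
Qed.

(* [w0] is a junk value, reached only for histories of probability zero. *)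
Definition hist_rep k (h : hist_type k) : T := xget w0 [set w | hist k w = h].

Lemma pr_ge0 u : 0 <= pr u.
Proof. by rewrite -lee_fin -(S_pr 0). Qed.

Lemma hist_weight_ge0 k (h : hist_type k) : 0 <= hist_weight h.
Proof. by rewrite -lee_fin -hist_prob. Qed.

Lemma hist_repK k (h : hist_type k) : 0 < hist_weight h -> hist k (hist_rep h) = h.
Proof.
move=> h0; rewrite /hist_rep; case: xgetP => [w _ //|none].
suff e : hist k @^-1` [set h] = set0.
  by move: h0; rewrite -lte_fin -hist_prob e measure0 ltxx.
by apply/seteqP; split=> w //= hw; case: (none w).
Qed.

(** Factorization through the finite set of histories takes the place of measurability with respect
    to the first [k] samples; integrability of real-valued [V] then follows, although nothing is
    assumed about measurability of the iterates. *)
Definition adapted (X : Type) (k : nat) (V : T -> X) : Prop :=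
  forall w w', hist k w = hist k w' -> V w = V w'.

Lemma hist_eqS k w w' : hist k.+1 w = hist k.+1 w' -> hist k w = hist k w'.
Proof. by case. Qed.

Lemma adaptedW (X : Type) k k' (V : T -> X) :
  (k <= k')%N -> adapted k V -> adapted k' V.
Proof.
move=> kk' aV; elim: k' kk' => [|k' IH]; first by rewrite leqn0 => /eqP <-.
rewrite leq_eqVlt => /orP[/eqP <- //|/IH a] w w' /hist_eqS.
exact: a.
Qed.

Definition mean (V : T -> R) : R := fine (\int[P]_w (V w)%:E).

Lemma adapted_integral k V : adapted k V ->
  (\int[P]_w (V w)%:E = (\sum_h hist_weight h * V (@hist_rep k h))%:E)%E.
Proof.
move=> aV.
have -> : (\int[P]_w (V w)%:E = \int[P]_w (V (hist_rep (hist k w)))%:E)%E.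
  apply: eq_integral => w _; congr EFin; apply: aV.
  by apply/esym/(xgetPex w0 (P := [set w' | hist k w' = hist k w])); exists w.
rewrite (integral_finite_map P (fun h => V (hist_rep h)) (@hist_measurable k)).
by congr EFin; apply: eq_bigr => h _; rewrite hist_prob.
Qed.

Lemma meanE k V : adapted k V -> mean V = \sum_h hist_weight h * V (@hist_rep k h).
Proof. by move=> aV; rewrite /mean (adapted_integral aV). Qed.

Lemma mean_integral k V : adapted k V -> (\int[P]_w (V w)%:E = (mean V)%:E)%E.
Proof. by move=> aV; rewrite (adapted_integral aV) (meanE aV). Qed.

Lemma mean_cst c : mean (fun=> c) = c.
Proof.
by rewrite /mean integral_cst//= probability_setT mule1. Qed.

Lemma mean_linear k a b V W : adapted k V -> adapted k W ->
  mean (fun w => a * V w + b * W w) = a * mean V + b * mean W.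
Proof.
move=> aV aW; have aVW : adapted k (fun w => a * V w + b * W w).
  by move=> w w' e; rewrite (aV _ _ e) (aW _ _ e).
rewrite (meanE aVW) (meanE aV) (meanE aW) !mulr_sumr -big_split.
by apply: eq_bigr => h _ /=; ring.
Qed.

Lemma mean_scale k c V : adapted k V -> mean (fun w => c * V w) = c * mean V.
Proof.
move=> aV; have := mean_linear c 0 aV aV; rewrite mul0r addr0 => <-.
by congr mean; apply/funext => w; rewrite mul0r addr0.
Qed.

Lemma mean_sum k m (c : nat -> R) (V : nat -> T -> R) :
  (forall i, (i < m)%N -> adapted k (V i)) ->
  mean (fun w => \sum_(i < m) c i * V i w) = \sum_(i < m) c i * mean (V i).
Proof.
elim: m => [|m IH] aV.
  rewrite big_ord0 -[RHS](mean_cst 0); congr mean.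
  by apply/funext => w; rewrite big_ord0.
have a' i : (i < m)%N -> adapted k (V i) by move=> im; apply/aV/(leq_trans im).
have aS : adapted k (fun w => \sum_(i < m) c i * V i w).
  by move=> w w' e; apply: eq_bigr => i _; rewrite (a' i (ltn_ord i) _ _ e).
rewrite big_ord_recr/= -IH//.
rewrite -[X in X + _]mul1r -(mean_linear 1 (c m) aS (aV m (ltnSn m))); congr mean.
by apply/funext => w; rewrite big_ord_recr/= mul1r.
Qed.

Lemma mean_le k V W : adapted k V -> adapted k W -> (forall w, V w <= W w) ->
  mean V <= mean W.
Proof.
move=> aV aW VW; rewrite (meanE aV) (meanE aW); apply: ler_sum => h _.
by rewrite ler_wpM2l// hist_weight_ge0.
Qed.

(** A supermartingale step without conditional expectations: by independence the weight of a history
    times [pr u] is the weight of the prolonged history. The outcomes [wA u] share the past of [w]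
    and have next sample [u]; this is promised only when [pr u] is positive, since otherwise no such
    outcome need exist. *)
Lemma mean_le_step k V W : adapted k V -> adapted k.+1 W ->
  (forall w (wA : U -> T), 0 < hist_weight (hist k w) ->
     (forall u, 0 < pr u -> hist k (wA u) = hist k w /\ S k (wA u) = u) ->
     \sum_u pr u * W (wA u) <= V w) ->
  mean W <= mean V.
Proof.
move=> aV aW step; rewrite (meanE aV) (meanE aW).
have -> : \sum_h hist_weight h * W (@hist_rep k.+1 h) =
    \sum_h \sum_u hist_weight h * pr u * W (@hist_rep k.+1 (h, u)).
  by rewrite pair_bigA; apply: eq_bigr => -[].
apply: ler_sum => h _.
under eq_bigr do rewrite -mulrA.
rewrite -mulr_sumr; have := hist_weight_ge0 h; rewrite le_eqVlt => /orP[/eqP <-|h0].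
  by rewrite !mul0r.
rewrite ler_pM2l//; apply: (step _ (fun u => @hist_rep k.+1 (h, u))) => [|u u0].
  by rewrite hist_repK.
rewrite (hist_repK h0).
have : 0 < @hist_weight k.+1 (h, u) by rewrite /= mulr_gt0.
by move=> /hist_repK /= [-> ->].
Qed.

End Histories.

(** * Runs of the algorithm *)

Section Run.
Context (R : realType) (n : nat) (f : 'rV[R]_n -> R) (psi : 'I_n -> R -> \bar R).
Context (v : 'I_n -> R) (tau : R) (K : nat) (sigma : R) (x0 : 'rV[R]_n).
Local Notation th0 := (tau / n%:R).
Local Notation vt := (vtheta n tau).
Local Notation inv := (inv_vtheta_pred_sq n tau).
Local Notation gam := (gamma n tau).

Record run := Run {
  run_x : nat -> 'rV[R]_n; run_y : nat -> 'rV[R]_n; run_z : nat -> 'rV[R]_n;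
  run_xplus : nat -> 'rV[R]_n; run_zplus : nat -> 'rV[R]_n;
  run_theta : nat -> R; run_s : nat -> nat }.

(** Restarts do not depend on the samples, so [s k] and [theta k] are deterministic: [s k = rt k]
    and [theta k = vt (k - rt k)]. This removes both from the notion of a run. *)
Fixpoint restart_time (k : nat) : nat :=
  if k is k'.+1 then if (K %| k')%N then k else restart_time k' else 0.
Local Notation rt := restart_time.

Lemma restart_time_le k : (rt k <= k)%N.
Proof. by elim: k => //= k IH; case: ifP => // _; exact: leqW. Qed.

Lemma restart_time_between t j k : rt k = t -> (t <= j <= k)%N -> rt j = t.
Proof.
elim: k => [|k IH] e /andP[tj jk].
  by move: jk; rewrite leqn0 => /eqP ->.
move: jk; rewrite leq_eqVlt => /orP[/eqP -> //|jk].
move: e => /=; case: ifP => [_ e|_ e]; last by apply: IH => //; rewrite tj.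
by move: tj; rewrite -e leqNgt jk.
Qed.

(* The weights of the point which the paper denotes by a ringed [x_j], before
   normalization by [Wsum]. *)
Definition average_coef (j i : nat) : R :=
  if (i < j)%N then gam j i * inv i else last_weight n tau j.

Lemma average_coef_sum (V : lmodType R) (c : nat -> V) j :
  \sum_(i < j.+1) average_coef j i *: c i =
  \sum_(i < j) (gam j i * inv i) *: c i + last_weight n tau j *: c j.
Proof.
rewrite big_ord_recr/= {2}/average_coef ltnn; congr (_ + _).
by apply: eq_bigr => i _; rewrite /average_coef ltn_ord.
Qed.

Lemma Wsum_average_coef j : Wsum n tau j = \sum_(i < j.+1) average_coef j i.
Proof.
have := @average_coef_sum R^o (fun=> 1) j; rewrite /Wsum.
under eq_bigr do rewrite [_ *: _]mulr1.
move=> ->; rewrite [_ *: _]mulr1; congr (_ + _).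
by apply: eq_bigr => i _; rewrite [RHS]mulr1.
Qed.

Definition is_run (S : nat -> {set 'I_n}) (r : run) : Prop :=
  [/\ run_x r 0 = x0, run_z r 0 = x0 &
   forall k, let th := vt (k - rt k) in
   [/\ run_y r k = (1 - th) *: run_x r k + th *: run_z r k,
       forall i, if i \in S k then
           is_minimizer
             (fun t : R => ((partial f i (run_y r k) * (t - run_y r k 0 i)
                + th * n%:R * v i / (2 * tau) * `|t - run_z r k 0 i| ^+ 2)%:E
                + psi i t)%E)
             (run_zplus r k 0 i)
         else run_zplus r k 0 i = run_z r k 0 i,
       run_xplus r k = run_y r k + (n%:R / tau * th) *: (run_zplus r k - run_z r k) &
       if (K %| k)%N then
         let j := (k.+1 - rt k)%N in
         run_x r k.+1 = sigma *: run_xplus r k + (1 - sigma) *: ((Wsum n tau j)^-1 *: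
           (\sum_(i < j) (gam j i * inv i) *: run_x r (rt k + i)%N
            + last_weight n tau j *: run_xplus r k))
         /\ run_z r k.+1 = run_x r k.+1
       else run_x r k.+1 = run_xplus r k /\ run_z r k.+1 = run_zplus r k]].

Lemma approx_restart_run (S : nat -> {set 'I_n}) x :
  approx_restart f psi v tau K sigma x0 S x ->
  exists2 r, is_run S r & run_x r = x.
Proof.
move=> [y [z [xp [zp [th [s [x00 z00 th00 s00 H]]]]]]].
have E k : s k = rt k /\ th k = vt (k - rt k).
  elim: k => [|k [IHs IHt]] //=.
  have [_ _ _] := H k; case: ifP => _ /=; first by case=> _ _ -> ->; rewrite subnn.
  by case=> _ _ -> ->; rewrite IHs IHt subSn ?restart_time_le.
exists (Run x y z xp zp th s) => //; split=> // k.
have [Es Et] := E k; have [h1 h2 h3 h4] := H k; rewrite /= -Et -Es; split=> //.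
by move: h4; case: ifP => _ [-> -> _ _].
Qed.

Section Facts.
Hypothesis f_convex : @convex_function R 'rV[R]_n setT f.
Hypothesis psi_cc : forall i : 'I_n, closed_convex (psi i).
Hypothesis th0_gt0 : 0 < th0.
Hypothesis th0_le1 : th0 <= 1.
Hypothesis sigma01 : 0 <= sigma <= 1.
Hypothesis x0_fin : finite_at psi x0.
Context (S : nat -> {set 'I_n}) (r : run).
Hypothesis r_run : is_run S r.

(* The iterates of the period starting at time [t], before the possible
   restart which ends it. *)
Definition period_x t i := if i is i'.+1 then run_xplus r (t + i') else run_x r t.
Definition period_z t i := if i is i'.+1 then run_zplus r (t + i') else run_z r t.

Lemma run_start t : rt t = t -> run_z r t = run_x r t.
Proof.
case: r_run => rx rz step; case: t => [_|t /=]; first by rewrite rx.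
have [_ _ _] := step t; case: ifP => [_ [_ ->]//|_ _ e].
by have := restart_time_le t; rewrite e ltnn.
Qed.

(** The hypothesis [rt (t + i) = t] means that the period begun at [t] is still running at time
    [t + i]. Iteration [t + i] may itself end in a restart, so [period_x t i.+1] belongs to the
    period even when it is no longer an iterate. *)
Lemma period_inside t i : rt (t + i) = t ->
  run_x r (t + i) = period_x t i /\ run_z r (t + i) = period_z t i.
Proof.
case: r_run => _ _ step; case: i => [|i]; first by rewrite addn0.
rewrite addnS /=; case: ifP => [_ e|nd e].
  by have := leq_addr i t; rewrite -{1}e ltnn.
by have [_ _ _] := step (t + i); rewrite nd.
Qed.

Lemma period_y t i : rt (t + i) = t ->
  run_y r (t + i) = (1 - vt i) *: period_x t i + vt i *: period_z t i.
Proof.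
move=> e; case: r_run => _ _ /(_ (t + i)%N) [-> _ _ _].
by rewrite e addKn; case: (period_inside e) => -> ->.
Qed.

Lemma period_xS t i : rt (t + i) = t ->
  period_x t i.+1 = run_y r (t + i)
    + (n%:R / tau * vt i) *: (period_z t i.+1 - period_z t i).
Proof.
move=> e; case: r_run => _ _ /(_ (t + i)%N) [_ _ /= -> _].
by rewrite e addKn; case: (period_inside e) => _ ->.
Qed.

Lemma period_combination t i : rt t = t ->
  (forall i', (i' < i)%N -> rt (t + i') = t) ->
  period_x t i = \sum_(l < i.+1) gam i l *: period_z t l.
Proof.
move=> tt; elim: i => [|i IH] H.
  by rewrite big_ord1 /= scale1r run_start.
rewrite gamma_recurrence// period_xS ?H// period_y ?H// -IH; last first.
  by move=> i' h; apply: H; exact: ltnW.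
rewrite -[n%:R / tau]invf_div scalerBr -!addrA; congr (_ + _).
by rewrite scalerBl -addrA [- _ + _]addrC.
Qed.

Lemma period_end t i : rt (t + i) = t -> (K %| t + i)%N ->
  run_x r (t + i).+1 = sigma *: period_x t i.+1 + (1 - sigma) *:
    ((Wsum n tau i.+1)^-1 *: \sum_(l < i.+2) average_coef i.+1 l *: period_x t l).
Proof.
move=> e Kd; case: r_run => _ _ /(_ (t + i)%N) [_ _ _].
rewrite Kd e -addnS addKn => -[-> _].
rewrite average_coef_sum; congr (_ + _ *: (_ *: (_ + _))).
apply: eq_bigr => l _; congr (_ *: _).
apply: (period_inside _).1; apply: restart_time_between e _.
by rewrite leq_addr leq_add2l -ltnS ltn_ord.
Qed.

Lemma zplus_finite k : finite_at psi (run_z r k) -> finite_at psi (run_zplus r k).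
Proof.
move=> zf i; case: r_run => _ _ /(_ k) [_ /(_ i) + _ _].
case: ifP => [_ umin|_ ->]; last exact: zf.
exact: (prox_fin_num (psi_cc i) umin (zf i)).
Qed.

Lemma period_x_finite t i : rt t = t ->
  (forall i', (i' < i)%N -> rt (t + i') = t) ->
  (forall l, (l <= i)%N -> finite_at psi (period_z t l)) ->
  finite_at psi (period_x t i) /\
  separable_fine psi (period_x t i)
    <= \sum_(l < i.+1) gam i l * separable_fine psi (period_z t l).
Proof.
move=> tt H Hz; rewrite period_combination//.
apply: (jensen (C := finite_at psi) (G := separable_fine psi)).
- by move=> a b s fa fb; exact: separable_fine_convex.
- by move=> l _; exact: gamma_ge0.
- by move=> l; exact: Hz.
- exact: gamma_sum1.
Qed.

Lemma restart_time_id k : rt (rt k) = rt k.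
Proof. by apply: (restart_time_between (erefl (rt k))); rewrite leqnn restart_time_le. Qed.

Lemma average_coef_ge0 j i : 0 <= average_coef j i.
Proof.
rewrite /average_coef; case: ifP => _; last exact/ltW/last_weight_gt0.
by rewrite mulr_ge0 ?gamma_ge0 ?inv_vtheta_pred_ge0.
Qed.

Lemma period_average_finite t j :
  (forall l, (l <= j)%N -> finite_at psi (period_x t l)) ->
  let xring := (Wsum n tau j)^-1 *: \sum_(l < j.+1) average_coef j l *: period_x t l in
  finite_at psi xring /\
  Wsum n tau j * objective_fine f psi xring
    <= \sum_(l < j.+1) average_coef j l * objective_fine f psi (period_x t l).
Proof.
move=> H /=; rewrite Wsum_average_coef.
apply: (convex_combination_ind (C := finite_at psi) (G := objective_fine f psi)).
- by move=> a b s fa fb; exact: objective_fine_convex.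
- by move=> l _; exact: average_coef_ge0.
- by move=> l; exact: H.
- by rewrite -Wsum_average_coef Wsum_gt0.
Qed.

(** Because of the extrapolation, finiteness of [psi] at [x_(k+1)] follows only from its finiteness
    at all the [z_l] of the period; the induction therefore keeps every earlier [z_j]. *)
Lemma run_finite k :
  finite_at psi (run_x r k) /\ forall j, (j <= k)%N -> finite_at psi (run_z r j).
Proof.
elim: k => [|k [IHx IHz]].
  have [rx rz _] := r_run; rewrite rx; split=> // j.
  by rewrite leqn0 => /eqP ->; rewrite rz.
pose t := rt k; pose i := (k - t)%N.
have tk : (t + i)%N = k by rewrite subnKC// restart_time_le.
have ti : rt (t + i) = t by rewrite tk.
have tl l : (l <= i)%N -> rt (t + l) = t.
  by move=> li; apply: restart_time_between ti _; rewrite leq_addr leq_add2l.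
have Zf l : (l <= i.+1)%N -> finite_at psi (period_z t l).
  rewrite leq_eqVlt => /orP[/eqP ->|li].
    by rewrite /= tk; apply: zplus_finite; exact: IHz.
  by rewrite -(period_inside (tl l li)).2; apply: IHz; rewrite -tk leq_add2l.
have Xf l : (l <= i.+1)%N -> finite_at psi (period_x t l).
  move=> li; apply: (period_x_finite _ _ _).1 => [|l' l'l|l' l'l].
  - exact: restart_time_id.
  - by apply: tl; rewrite -ltnS (leq_trans l'l).
  - by apply: Zf; rewrite (leq_trans l'l).
have [_ _ /(_ k) [_ _ _]] := r_run; case: ifP => [Kd [_ zx]|nd [xx zz]].
  have xf : finite_at psi (run_x r k.+1).
    rewrite -tk period_end ?tk//.
    have [af _] := period_average_finite Xf.
    by have [] := separable_fine_convex psi_cc (Xf i.+1 (leqnn _)) af sigma01.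
  split=> // j; rewrite leq_eqVlt => /orP[/eqP ->|]; [by rewrite zx|exact: IHz].
split; first by have := Xf i.+1 (leqnn _); rewrite /= tk xx.
move=> j; rewrite leq_eqVlt => /orP[/eqP ->|]; last exact: IHz.
by have := Zf i.+1 (leqnn _); rewrite /= tk zz.
Qed.

End Facts.

Lemma prox_weight_gt0 (i : 'I_n) t : (forall i, 0 < v i) -> 0 < tau -> 0 < t ->
  0 < t * n%:R * v i / (2 * tau).
Proof.
have n0 : 0 < n%:R :> R by rewrite ltr0n (leq_ltn_trans _ (ltn_ord i)).
by move=> v0 tau0 t0; apply: divr_gt0; do ?apply: mulr_gt0.
Qed.

Lemma run_unique (S S' : nat -> {set 'I_n}) r r' k :
  (forall i : 'I_n, closed_convex (psi i)) -> (forall i, 0 < v i) -> 0 < tau ->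
  0 < th0 -> th0 <= 1 -> @convex_function R 'rV[R]_n setT f ->
  0 <= sigma <= 1 -> finite_at psi x0 ->
  is_run S r -> is_run S' r' -> (forall j, (j < k)%N -> S j = S' j) ->
  [/\ forall j, (j <= k)%N -> run_x r j = run_x r' j /\ run_z r j = run_z r' j &
      forall j, (j < k)%N -> run_xplus r j = run_xplus r' j /\
                            run_zplus r j = run_zplus r' j].
Proof.
move=> psi_cc v0 tau0 h0 h1 fc s01 x0f rr rr'; elim: k => [|k IH] SS.
  split=> // j; rewrite leqn0 => /eqP ->.
  by have [-> -> _] := rr; have [-> -> _] := rr'.
have [IHx IHp] := IH (fun j jk => SS j (ltnW jk)).
have [Ex Ez] := IHx k (leqnn k).
have [_ _ /(_ k) [yE zE xE nE]] := rr; have [_ _ /(_ k) [yE' zE' xE' nE']] := rr'.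
have Ey : run_y r k = run_y r' k by rewrite yE yE' Ex Ez.
have Ezp : run_zplus r k = run_zplus r' k.
  apply/rowP => i; have := zE i; have := zE' i; rewrite -SS// -Ey -Ez.
  case: ifP => [_ u' u|_ -> ->//].
  have [_ /(_ k (leqnn k)) zf] := run_finite fc psi_cc h0 h1 s01 x0f rr k.
  have c0 : 0 < vt (k - rt k) * n%:R * v i / (2 * tau).
    exact: prox_weight_gt0 (vtheta_gt0 h0 _).
  apply: (prox_unique (psi_cc i) _ _ u u' (zf i)).
    exact: ltW.
  exact: c0.
have Exp : run_xplus r k = run_xplus r' k by rewrite xE xE' Ey Ezp Ez.
have Hp j : (j < k.+1)%N -> run_xplus r j = run_xplus r' j /\
                            run_zplus r j = run_zplus r' j.
  by rewrite ltnS leq_eqVlt => /orP[/eqP ->//|/IHp].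
split=> // j; rewrite leq_eqVlt => /orP[/eqP ->|]; last by rewrite ltnS; exact: IHx.
move: nE nE'; case: ifP => [_ [ex ->] [ex' ->]|_ [-> ->] [-> ->]]; last exact: Hp.
have -> // : run_x r k.+1 = run_x r' k.+1.
rewrite ex ex' Exp; congr (_ + _ *: (_ *: (_ + _))).
apply: eq_bigr => l _; congr (_ *: _); apply: (IHx _ _).1.
have lk : (l <= k - rt k)%N by rewrite -ltnS -subSn ?restart_time_le.
by apply: leq_trans (leq_add (leqnn (rt k)) lk) _; rewrite subnKC ?restart_time_le.
Qed.

End Run.

(** * Expected decrease over a period *)

Section Period.
Context (R : realType) (n : nat) (f : 'rV[R]_n -> R) (psi : 'I_n -> R -> \bar R).
Hypothesis f_convex : @convex_function R 'rV[R]_n setT f.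
Hypothesis f_diff : forall x : 'rV[R]_n, differentiable f x.
Hypothesis psi_cc : forall i : 'I_n, closed_convex (psi i).
Context (v : 'I_n -> R) (tau : R) (K : nat) (sigma : R) (x0 xs : 'rV[R]_n).
Hypothesis v_gt0 : forall i, 0 < v i.
Hypothesis tau_gt0 : 0 < tau.
Local Notation th0 := (tau / n%:R).
Hypothesis th0_gt0 : 0 < th0.
Hypothesis th0_le1 : th0 <= 1.
Hypothesis sigma01 : 0 <= sigma <= 1.
Hypothesis x0_fin : finite_at psi x0.
Hypothesis xs_fin : finite_at psi xs.
Context (muF : R).
Hypothesis muF_gt0 : 0 < muF.
Hypothesis F_growth : forall x, finite_at psi x ->
  objective_fine f psi xs + muF / 2 * wnorm2 v (x - xs) <= objective_fine f psi x.
Context d (T : measurableType d) (P : probability T R) (S : nat -> T -> {set 'I_n}).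
Context (pr : {set 'I_n} -> R) (w0 : T).
Hypothesis S_meas : forall k, discrete_measurable_map (S k).
Hypothesis S_pr : forall k u, P (S k @^-1` [set u]) = (pr u)%:E.
Hypothesis S_indep : mutually_independent P S.
Hypothesis pr_sum : \sum_A pr A = 1.
Hypothesis pr_marginal : forall i, \sum_(A : {set 'I_n} | i \in A) pr A = th0.
Hypothesis eso : forall x h : 'rV[R]_n,
  \sum_A pr A * f (x + restrict_to A h)
    <= f x + th0 * (\sum_(i < n) partial f i x * h 0 i + 1 / 2 * wnorm2 v h).
Context (r : T -> run R n).
Hypothesis r_run : forall w, is_run f psi v tau K sigma x0 (fun k => S k w) (r w).

Local Notation vt := (vtheta n tau).
Local Notation inv := (inv_vtheta_pred_sq n tau).
Local Notation gam := (gamma n tau).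
Local Notation rt := (restart_time K).
Local Notation F := (objective_fine f psi).
Local Notation X t i w := (period_x (r w) t i).
Local Notation Z t i w := (period_z (r w) t i).

(* [theta_0^2 Delta x]. *)
Definition potential (x : 'rV[R]_n) : R :=
  (1 - th0) * (F x - F xs) + 1 / 2 * wnorm2 v (x - xs).

(* [theta_0^2 ((hatF_i - F xs) / vtheta_(i-1)^2 + |z_i - xs|^2 / (2 theta_0^2))],
   where [hatF_i >= F x_i] replaces [psi x_i] by the same combination of the
   [psi z_l] which expresses [x_i] through the [z_l]. *)
Definition lyapunov t i w : R :=
  th0 ^+ 2 * inv i * (f (X t i w)
     + \sum_(l < i.+1) gam i l * separable_fine psi (Z t l w) - F xs)
  + 1 / 2 * wnorm2 v (Z t i w - xs).

Lemma hist_sample k w w' : hist S k w = hist S k w' ->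
  forall j, (j < k)%N -> S j w = S j w'.
Proof.
elim: k => // k IH [hk Sk] j; rewrite ltnS leq_eqVlt => /orP[/eqP ->//|].
exact: IH.
Qed.

Lemma run_adapted k w w' : hist S k w = hist S k w' ->
  (forall j, (j <= k)%N ->
     run_x (r w) j = run_x (r w') j /\ run_z (r w) j = run_z (r w') j) /\
  (forall j, (j < k)%N -> run_xplus (r w) j = run_xplus (r w') j /\
     run_zplus (r w) j = run_zplus (r w') j).
Proof.
move=> e; exact: (run_unique psi_cc v_gt0 tau_gt0 th0_gt0 th0_le1 f_convex
  sigma01 x0_fin (r_run w) (r_run w') (hist_sample e)).
Qed.

Lemma period_x_adapted t i : adapted S (t + i) (fun w => X t i w).
Proof.
move=> w w' /run_adapted [h1 h2]; case: i h1 h2 => [|i] h1 h2 /=.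
  by case: (h1 t); rewrite ?leq_addr.
by case: (h2 (t + i)%N); rewrite ?addnS.
Qed.

Lemma period_z_adapted t i : adapted S (t + i) (fun w => Z t i w).
Proof.
move=> w w' /run_adapted [h1 h2]; case: i h1 h2 => [|i] h1 h2 /=.
  by case: (h1 t); rewrite ?leq_addr.
by case: (h2 (t + i)%N); rewrite ?addnS.
Qed.

Lemma lyapunov_adapted t i : adapted S (t + i) (lyapunov t i).
Proof.
move=> w w' e; rewrite /lyapunov (period_x_adapted e) (period_z_adapted e).
congr (_ * (_ + _ - _) + _); apply: eq_bigr => l _; congr (_ * separable_fine _ _).
by apply: (adaptedW _ (@period_z_adapted t l) e); rewrite leq_add2l -ltnS.
Qed.

Lemma period_finite t i w : rt (t + i) = t -> forall l, (l <= i.+1)%N ->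
  [/\ finite_at psi (X t l w), finite_at psi (Z t l w) &
      separable_fine psi (X t l w)
        <= \sum_(j < l.+1) gam l j * separable_fine psi (Z t j w)].
Proof.
move=> ti; have rf := run_finite f_convex psi_cc th0_gt0 th0_le1 sigma01 x0_fin (r_run w).
have tl l : (l <= i)%N -> rt (t + l) = t.
  by move=> li; apply: restart_time_between ti _; rewrite leq_addr leq_add2l.
have tt : rt t = t by have := tl 0%N (leq0n i); rewrite addn0.
have Zf l : (l <= i.+1)%N -> finite_at psi (Z t l w).
  rewrite leq_eqVlt => /orP[/eqP ->|li].
    apply: (zplus_finite psi_cc (r_run w)).
    by case: (rf (t + i)%N) => _; apply.
  rewrite -(period_inside (r_run w) (tl l li)).2.
  by case: (rf (t + l)%N) => _; apply.
move=> l li.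
have [] := period_x_finite (i := l) psi_cc th0_gt0 th0_le1 (r_run w) tt.
- by move=> i' il; apply: tl; rewrite -ltnS (leq_trans il).
- by move=> j jl; apply: Zf; rewrite (leq_trans jl).
- by move=> h1 h2; split=> //; exact: Zf.
Qed.

Lemma lyapunov_step t i : rt (t + i) = t ->
  mean P (lyapunov t i.+1) <= mean P (lyapunov t i).
Proof.
move=> ti; have aL := @lyapunov_adapted t i.
have aL' : adapted S (t + i).+1 (lyapunov t i.+1).
  by rewrite -addnS; exact: lyapunov_adapted.
apply: (mean_le_step w0 S_meas S_pr S_indep aL aL') => w wA _ HA.
set k := (t + i)%N in ti aL aL' HA *.
(* Every coordinate is sampled with positive probability after the present
   history, so the full proximal point [u] exists. *)
have /choice[a Ha] : forall j : 'I_n, exists A : {set 'I_n}, j \in A /\ 0 < pr A.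
  move=> j; apply: contrapT => none.
  have : th0 <= 0.
    rewrite -(pr_marginal j); apply: sumr_le0 => A jA.
    by rewrite leNgt; apply/negP => A0; apply: none; exists A.
  by rewrite leNgt th0_gt0.
pose u := \row_j run_zplus (r (wA (a j))) k 0 j.
have same A : 0 < pr A -> [/\ run_x (r (wA A)) k = run_x (r w) k,
    run_z (r (wA A)) k = run_z (r w) k, run_y (r (wA A)) k = run_y (r w) k &
    forall l, (l <= i)%N -> X t l (wA A) = X t l w /\ Z t l (wA A) = Z t l w].
  move=> A0; have [eh _] := HA A A0.
  have [/(_ k (leqnn k)) [ex ez] _] := run_adapted eh.
  have [_ _ /(_ k) [yA _ _ _]] := r_run (wA A).
  have [_ _ /(_ k) [yw _ _ _]] := r_run w.
  split=> // [|l li]; first by rewrite yA yw ex ez.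
  have tlk : (t + l <= k)%N by rewrite leq_add2l.
  by split; [exact: (adaptedW tlk (@period_x_adapted t l) eh)
            |exact: (adaptedW tlk (@period_z_adapted t l) eh)].
have [Xk Zk] := period_inside (r_run w) ti.
have umin j : is_minimizer
     (fun s : R => ((partial f j (run_y (r w) k) * (s - run_y (r w) k 0 j)
        + vt i * n%:R * v j / (2 * tau) * `|s - Z t i w 0 j| ^+ 2)%:E + psi j s)%E)
     (u 0 j).
  have [ja a0] := Ha j; have [_ ez ey _] := same _ a0.
  have [_ _ /(_ k) [_ /(_ j) + _ _]] := r_run (wA (a j)).
  have [_ ->] := HA _ a0; rewrite ja ez ey ti -Zk mxE.
  by rewrite /k addKn.
have [_ zf _] := period_finite w ti (leqnSn i).
have yE := period_y (r_run w) ti.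
have := accelerated_step f_convex f_diff psi_cc v_gt0 xs_fin th0_gt0 pr_sum
  pr_marginal eso (\sum_(l < i.+1) gam i l * separable_fine psi (Z t l w))
  (vtheta_gt0 th0_gt0 i) (vtheta_le1 th0_gt0 th0_le1 i) yE zf umin.
(* The coordinates of [u] were taken from different outcomes with the same past. Uniqueness of
   proximal points identifies them with the blocks updated under any other sample [A]. *)
have zpE A : 0 < pr A -> Z t i.+1 (wA A) = block_update (Z t i w) u A.
  move=> A0; have [ex ez ey _] := same A A0; apply/rowP => j; rewrite [RHS]mxE.
  have [_ _ /(_ k) [_ /(_ j) + _ _]] := r_run (wA A).
  have [_ ->] := HA _ A0; rewrite ez ey ti {1 2}/k addKn Zk.
  case: ifP => [jA um|_ //].
  have c0 := prox_weight_gt0 j v_gt0 tau_gt0 (vtheta_gt0 th0_gt0 i).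
  exact: (prox_unique (psi_cc j) (ltW c0) c0 um (umin j) (zf j)).
have xpE A : 0 < pr A -> X t i.+1 (wA A) = run_y (r w) (t + i)
    + (n%:R / tau * vt i) *: (block_update (Z t i w) u A - Z t i w).
  move=> A0; have [_ _ ey /(_ i (leqnn i)) [_ ezi]] := same A A0.
  by rewrite (period_xS (r_run (wA A)) ti) ey zpE// ezi.
have psE A : 0 < pr A ->
    \sum_(l < i.+2) gam i.+1 l * separable_fine psi (Z t l (wA A))
    = (1 - vt i) * (\sum_(l < i.+1) gam i l * separable_fine psi (Z t l w))
      + (vt i - th0^-1 * vt i) * separable_fine psi (Z t i w)
      + th0^-1 * vt i * separable_fine psi (block_update (Z t i w) u A).
  move=> A0; have [_ _ _ H] := same A A0.
  rewrite (gamma_recurrenceR th0_gt0 (fun l => separable_fine psi (Z t l (wA A)))).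
  rewrite zpE// (H i (leqnn i)).2; congr (_ * _ + _ + _).
  by apply: eq_bigr => l _; rewrite (H l _).2// -ltnS.
have vt0 := vtheta_gt0 th0_gt0 i.
(* This factor turns the step inequality into the Lyapunov one: [th0^2 / vt_i^2] is
   [th0^2 * inv i.+1] on the new side, and times [1 - vt_i] it is [th0^2 * inv i] on the old
   side. *)
have q0 : 0 < th0 ^+ 2 / vt i ^+ 2 by rewrite divr_gt0// exprn_gt0.
rewrite -(ler_pM2l q0); set C := (X in _ <= X -> _).
have -> : C = lyapunov t i w.
  rewrite /C /lyapunov inv_vtheta_predE//; move: (vt i) vt0 => b b0.
  move: th0 th0_gt0 => h h0.
  by field; rewrite !gt_eqF.
apply: le_trans; rewrite le_eqVlt; apply/orP; left; apply/eqP.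
rewrite mulr_sumr; apply: eq_bigr => A _.
have := pr_ge0 S_pr A; rewrite le_eqVlt => /orP[/eqP <-|A0].
  by rewrite !mul0r mulr0.
rewrite /lyapunov xpE// psE// zpE// {1}/inv_vtheta_pred_sq.
move: (vt i) vt0 => b b0; move: th0 th0_gt0 => h h0.
by field; rewrite !gt_eqF.
Qed.

Lemma restart_time_start t i : rt (t + i) = t -> rt t = t.
Proof. by move=> ti; apply: restart_time_between ti _; rewrite leqnn leq_addr. Qed.

(** A period starts with [z = x], and [th0 ^+ 2 * inv 0 = 1 - th0] is exactly the weight of the gap
    in the potential. *)
Lemma lyapunov0 t w : rt t = t -> lyapunov t 0 w = potential (run_x (r w) t).
Proof.
move=> tt; rewrite /lyapunov /potential inv_vtheta_predE// big_ord1 vtheta0.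
have -> : X t 0 w = run_x (r w) t by [].
have zE : Z t 0 w = run_x (r w) t := run_start (r_run w) tt.
rewrite -[gam 0 _]/(1 : R) -[Z t ord0 w]/(Z t 0 w) zE mul1r -/(F _).
by congr (_ * _ + _); move: th0 th0_gt0 => h h0; field; rewrite gt_eqF.
Qed.

Lemma mean_lyapunov_le t i : rt (t + i) = t -> forall l, (l <= i.+1)%N ->
  mean P (lyapunov t l) <= mean P (fun w => potential (run_x (r w) t)).
Proof.
move=> ti; elim=> [_|l IH li].
  rewrite le_eqVlt; apply/orP; left; apply/eqP; congr mean; apply/funext => w.
  exact/lyapunov0/(restart_time_start ti).
apply: le_trans (IH (ltnW li)); apply: lyapunov_step.
by apply: restart_time_between ti _; rewrite leq_addr leq_add2l -ltnS.
Qed.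

Definition average_gap t j w : R :=
  \sum_(l < j.+1) average_coef n tau j l * (F (X t l w) - F xs).

(* Sum the Lyapunov functions with the weights [gamma_j^l] and use convexity of
   the squared norm; of the coefficient [1 / (theta_0 vtheta_(j-1))] of the last
   gap, the part [(1 - theta_0) / theta_0^2] goes to the potential. *)
Lemma period_potential_le t i w : rt (t + i) = t ->
  th0 ^+ 2 * average_gap t i.+1 w + potential (X t i.+1 w)
    <= \sum_(l < i.+2) gam i.+1 l * lyapunov t l w.
Proof.
move=> ti; have fin := period_finite w ti.
have h2 : 0 <= th0 ^+ 2 by rewrite exprn_ge0// ltW.
have L_ge l : (l <= i.+1)%N -> th0 ^+ 2 * inv l * (F (X t l w) - F xs)
    + 1 / 2 * wnorm2 v (Z t l w - xs) <= lyapunov t l w.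
  move=> li; have [_ _ hl] := fin l li; rewrite /lyapunov lerD2r.
  apply: ler_wpM2l; first by rewrite mulr_ge0// inv_vtheta_pred_ge0.
  by rewrite lerD2r [F (X _ _ _)]/objective_fine lerD2l.
have N_le : wnorm2 v (X t i.+1 w - xs)
    <= \sum_(l < i.+2) gam i.+1 l * wnorm2 v (Z t l w - xs).
  rewrite (period_combination th0_gt0 (r_run w) (restart_time_start ti)); last first.
    by move=> i' h; apply: restart_time_between ti _; rewrite leq_addr leq_add2l -ltnS.
  apply: (jensen (C := fun=> True) (G := fun x => wnorm2 v (x - xs)) _ _ _ _).2 => //.
  - move=> a b s _ _ s01; split=> //.
    by apply: wnorm2_convex => // j; exact: ltW.
  - by move=> l _; exact: gamma_ge0.
  - exact: gamma_sum1.
have E : \sum_(l < i.+2) gam i.+1 l * (th0 ^+ 2 * inv l * (F (X t l w) - F xs)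
     + 1 / 2 * wnorm2 v (Z t l w - xs))
  = th0 ^+ 2 * average_gap t i.+1 w + (1 - th0) * (F (X t i.+1 w) - F xs)
    + 1 / 2 * \sum_(l < i.+2) gam i.+1 l * wnorm2 v (Z t l w - xs).
  under eq_bigr do rewrite mulrDr.
  rewrite big_split/=; congr (_ + _); last first.
    by rewrite mulr_sumr; apply: eq_bigr => l _; ring.
  have -> : average_gap t i.+1 w =
      \sum_(l < i.+1) (gam i.+1 l * inv l) * (F (X t l w) - F xs)
      + last_weight n tau i.+1 * (F (X t i.+1 w) - F xs).
    exact: (@average_coef_sum R n tau R^o (fun l => F (X t l w) - F xs) i.+1).
  transitivity (\sum_(l < i.+1) gam i.+1 l * (th0 ^+ 2 * inv l * (F (X t l w) - F xs))
      + gam i.+1 i.+1 * (th0 ^+ 2 * inv i.+1 * (F (X t i.+1 w) - F xs))).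
    by rewrite big_ord_recr.
  rewrite [in RHS]mulrDr mulr_sumr -[RHS]addrA; congr (_ + _).
    by apply: eq_bigr => l _; ring.
  rewrite /last_weight -(gamma_diag_inv th0_gt0) vtheta0.
  move: (gam _ _) (inv _) th0 th0_gt0 => g a h h0.
  by field; rewrite gt_eqF.
apply: (@le_trans _ _ (\sum_(l < i.+2) gam i.+1 l * (th0 ^+ 2 * inv l * (F (X t l w) - F xs)
     + 1 / 2 * wnorm2 v (Z t l w - xs)))).
  by rewrite E /potential; move: N_le; lra.
apply: ler_sum => l _; rewrite ler_wpM2l ?gamma_ge0//.
by apply: L_ge; rewrite -ltnS.
Qed.

Lemma average_gap_adapted t j : adapted S (t + j) (average_gap t j).
Proof.
move=> w w' e; apply: eq_bigr => l _; congr (_ * (F _ - _)).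
by apply: (adaptedW _ (@period_x_adapted t l) e); rewrite leq_add2l -ltnS.
Qed.

Lemma potential_adapted t j : adapted S (t + j) (fun w => potential (X t j w)).
Proof. by move=> w w' e; rewrite (period_x_adapted e). Qed.

Lemma mean_period_le t i : rt (t + i) = t ->
  th0 ^+ 2 * mean P (average_gap t i.+1) + mean P (fun w => potential (X t i.+1 w))
    <= mean P (fun w => potential (run_x (r w) t)).
Proof.
move=> ti.
have aA := @average_gap_adapted t i.+1; have aD := @potential_adapted t i.+1.
rewrite -[mean P (fun w => potential _)]mul1r -(mean_linear w0 S_meas S_pr S_indep _ _ aA aD).
have aL l : (l < i.+2)%N -> adapted S (t + i.+1) (lyapunov t l).
  by move=> li; apply: (adaptedW _ (@lyapunov_adapted t l)); rewrite leq_add2l -ltnS.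
apply: (@le_trans _ _ (mean P (fun w => \sum_(l < i.+2) gam i.+1 l * lyapunov t l w))).
  apply: (mean_le w0 S_meas S_pr S_indep (k := t + i.+1)).
  - by move=> w w' e; rewrite (aA _ _ e) (aD _ _ e).
  - by move=> w w' e; apply: eq_bigr => l _; rewrite (aL l (ltn_ord l) _ _ e).
  - by move=> w; rewrite mul1r; exact: period_potential_le.
rewrite (mean_sum w0 S_meas S_pr S_indep _ aL).
rewrite -[leRHS]mul1r -(gamma_sum1 th0_gt0 i.+1) mulr_suml; apply: ler_sum => l _.
rewrite ler_wpM2l ?gamma_ge0//; apply: (mean_lyapunov_le ti).
by rewrite -ltnS.
Qed.

Lemma potential_convex a b t : finite_at psi a -> finite_at psi b -> 0 <= t <= 1 ->
  finite_at psi (t *: a + (1 - t) *: b) /\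
  potential (t *: a + (1 - t) *: b) <= t * potential a + (1 - t) * potential b.
Proof.
move=> fa fb t01; have [fab hF] := objective_fine_convex psi_cc f_convex fa fb t01.
split=> //; have hN := wnorm2_convex xs a b (fun i => ltW (v_gt0 i)) t01.
have {}hF := ler_wpM2l (_ : 0 <= 1 - th0) hF.
rewrite subr_ge0 in hF; have {}hF := hF th0_le1.
by rewrite /potential; move: hF hN; lra.
Qed.

Lemma objective_gap_ge x : finite_at psi x ->
  muF / 2 * wnorm2 v (x - xs) <= F x - F xs.
Proof. by move=> /F_growth; rewrite lerBrDl. Qed.

Lemma potential_ge0 x : finite_at psi x -> 0 <= potential x.
Proof.
move=> xf; have := objective_gap_ge xf.
have N0 := wnorm2_ge0 (x - xs) (fun i => ltW (v_gt0 i)); move=> h.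
have F0 : 0 <= F x - F xs by apply: le_trans h; rewrite mulr_ge0// divr_ge0// ltW.
by apply: addr_ge0; apply: mulr_ge0 => //; rewrite ?subr_ge0 ?divr_ge0.
Qed.

Definition period_average t j w : 'rV[R]_n :=
  (Wsum n tau j)^-1 *: \sum_(l < j.+1) average_coef n tau j l *: X t l w.

Lemma period_average_adapted t j : adapted S (t + j) (period_average t j).
Proof.
move=> w w' e; congr (_ *: _); apply: eq_bigr => l _; congr (_ *: _).
by apply: (adaptedW _ (@period_x_adapted t l) e); rewrite leq_add2l -ltnS.
Qed.

Lemma period_x_fin t i w : rt (t + i) = t -> forall l, (l <= i.+1)%N ->
  finite_at psi (X t l w).
Proof. by move=> ti l li; case: (period_finite w ti li). Qed.

(** Origin of [mcoef]: with [G] the gap at the average, strong convexity bounds its potential by [(1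
    - th0) G + G / muF = (1 + muF (1 - th0)) / muF * G], while Jensen bounds the weighted gaps below
    by [W * G]. *)
Lemma average_gap_ge t i w : rt (t + i) = t ->
  [/\ finite_at psi (period_average t i.+1 w), 0 <= average_gap t i.+1 w &
  mcoef n tau i.+1 muF * potential (period_average t i.+1 w)
    <= th0 ^+ 2 * average_gap t i.+1 w].
Proof.
move=> ti; have [af ale] := period_average_finite f_convex psi_cc th0_gt0 th0_le1
  (period_x_fin w ti).
rewrite -/(period_average t i.+1 w) in af ale.
have W0 := Wsum_gt0 th0_gt0 th0_le1 i.+1.
have gap : Wsum n tau i.+1 * (F (period_average t i.+1 w) - F xs) <= average_gap t i.+1 w.
  rewrite /average_gap; under eq_bigr do rewrite mulrBr.
  by rewrite sumrB -mulr_suml -Wsum_average_coef mulrBr lerD2r.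
have hg := objective_gap_ge af.
have N0 := wnorm2_ge0 (period_average t i.+1 w - xs) (fun i => ltW (v_gt0 i)).
have F0 : 0 <= F (period_average t i.+1 w) - F xs.
  by apply: le_trans hg; rewrite mulr_ge0// divr_ge0// ltW.
have g0 : 0 <= average_gap t i.+1 w.
  by apply: le_trans gap; rewrite mulr_ge0// ltW.
split=> //.
apply: (@le_trans _ _ (th0 ^+ 2 * (Wsum n tau i.+1 * (F (period_average t i.+1 w) - F xs)))).
  have c0 : 0 < 1 + muF * (1 - th0) by rewrite ltr_wpDr// mulr_ge0 ?subr_ge0// ltW.
  rewrite /mcoef /potential.
  move: (F _ - _) (wnorm2 _ _) (Wsum _ _ _) W0 hg F0 => G N W W0 hg F0.
  have -> : th0 ^+ 2 * (W * G) = muF * th0 ^+ 2 / (1 + muF * (1 - th0)) * W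
      * ((1 - th0) * G + muF^-1 * G).
    by move: th0 c0 => h c0; field; rewrite !gt_eqF.
  have c1 : 0 <= muF * th0 ^+ 2 / (1 + muF * (1 - th0)) * W.
    by apply/ltW/mulr_gt0 => //; apply: divr_gt0 => //; rewrite mulr_gt0 ?exprn_gt0.
  apply: (ler_wpM2l c1); rewrite lerD2l -(ler_pM2l muF_gt0) mulrA.
  by rewrite mulVKf ?gt_eqF// mul1r.
by rewrite ler_wpM2l// exprn_ge0// ltW.
Qed.

Lemma mean_average_gap_ge0 t i : rt (t + i) = t -> 0 <= mean P (average_gap t i.+1).
Proof.
move=> ti; rewrite -(mean_cst P 0).
apply: (mean_le w0 S_meas S_pr S_indep (k := t + i.+1)) => //.
  exact: average_gap_adapted.
by move=> w; case: (average_gap_ge w ti).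
Qed.

Lemma mean_potential_period t i : rt (t + i) = t -> forall l, (l <= i.+1)%N ->
  mean P (fun w => potential (X t l w)) <= mean P (fun w => potential (run_x (r w) t)).
Proof.
move=> ti [//|l] li.
have tl : rt (t + l) = t.
  by apply: restart_time_between ti _; rewrite leq_addr leq_add2l -ltnS.
apply: le_trans (mean_period_le tl); rewrite lerDr mulr_ge0 ?mean_average_gap_ge0//.
by rewrite exprn_ge0// ltW.
Qed.

Lemma mean_potential_average t i : rt (t + i) = t ->
  mean P (fun w => potential (period_average t i.+1 w))
    <= mean P (fun w => potential (run_x (r w) t)).
Proof.
move=> ti; have W0 := Wsum_gt0 th0_gt0 th0_le1 i.+1.
have aA : adapted S (t + i.+1) (fun w => potential (period_average t i.+1 w)).
  by move=> w w' e; rewrite (period_average_adapted e).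
have aX l : (l < i.+2)%N -> adapted S (t + i.+1) (fun w => potential (X t l w)).
  by move=> li; apply: (adaptedW _ (@potential_adapted t l)); rewrite leq_add2l -ltnS.
rewrite -(ler_pM2l W0) -(mean_scale w0 S_meas S_pr S_indep _ aA).
apply: (@le_trans _ _ (mean P (fun w =>
    \sum_(l < i.+2) average_coef n tau i.+1 l * potential (X t l w)))).
  apply: (mean_le w0 S_meas S_pr S_indep (k := t + i.+1)).
  - by move=> w w' e; rewrite (aA _ _ e).
  - by move=> w w' e; apply: eq_bigr => l _; rewrite (aX l (ltn_ord l) _ _ e).
  - move=> w; rewrite /period_average Wsum_average_coef.
    apply: (convex_combination_ind (C := finite_at psi) (G := potential) _ _ _ _).2.
    + by move=> a b s fa fb; exact: potential_convex.
    + by move=> l _; exact: average_coef_ge0.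
    + by move=> l; exact: (period_x_fin w ti).
    + by rewrite -Wsum_average_coef.
rewrite (mean_sum w0 S_meas S_pr S_indep _ aX) Wsum_average_coef mulr_suml.
apply: ler_sum => l _; rewrite ler_wpM2l ?average_coef_ge0//.
by apply: (mean_potential_period ti); rewrite -ltnS.
Qed.

(* With [D] the potential, [A] the average and [m = mcoef], the period gives
   [E D(x) + m E D(A) <= D_0] and [E D(A) <= D_0]; substituting the first bound,
   [sigma E D(x) + (1 - sigma) E D(A)] is at most
   [sigma D_0 + (1 - sigma - sigma m) E D(A)], and the sign of the last factor
   decides which of the two rates is attained. *)
Lemma mean_potential_restart t i rho : rt (t + i) = t -> (K %| t + i)%N ->
  sigma <= rho -> 1 - sigma * mcoef n tau i.+1 muF <= rho ->
  mean P (fun w => potential (run_x (r w) (t + i).+1))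
    <= rho * mean P (fun w => potential (run_x (r w) t)).
Proof.
move=> ti Kd rho1 rho2; set D0 := mean P (fun w => potential (run_x (r w) t)).
have aA : adapted S (t + i.+1) (fun w => potential (period_average t i.+1 w)).
  by move=> w w' e; rewrite (period_average_adapted e).
have aX := @potential_adapted t i.+1.
have aG := @average_gap_adapted t i.+1.
have hX := mean_period_le ti; have hA := mean_potential_average ti.
have A0 : 0 <= mean P (fun w => potential (period_average t i.+1 w)).
  rewrite -(mean_cst P 0); apply: (mean_le w0 S_meas S_pr S_indep (k := t + i.+1)) => // w.
  by apply: potential_ge0; case: (average_gap_ge w ti).
have hG : mcoef n tau i.+1 muF * mean P (fun w => potential (period_average t i.+1 w))
    <= th0 ^+ 2 * mean P (average_gap t i.+1).
  rewrite -(mean_scale w0 S_meas S_pr S_indep _ aA) -(mean_scale w0 S_meas S_pr S_indep _ aG).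
  apply: (mean_le w0 S_meas S_pr S_indep (k := t + i.+1)).
  - by move=> w w' e; rewrite (aA _ _ e).
  - by move=> w w' e; rewrite (aG _ _ e).
  - by move=> w; case: (average_gap_ge w ti).
have hR : mean P (fun w => potential (run_x (r w) (t + i).+1))
    <= sigma * mean P (fun w => potential (X t i.+1 w))
       + (1 - sigma) * mean P (fun w => potential (period_average t i.+1 w)).
  rewrite -(mean_linear w0 S_meas S_pr S_indep _ _ aX aA).
  apply: (mean_le w0 S_meas S_pr S_indep (k := t + i.+1)).
  - move=> w w' e; have [h _] := run_adapted e.
    by rewrite (h (t + i).+1 _).1// addnS.
  - by move=> w w' e; rewrite (aX _ _ e) (aA _ _ e).
  - move=> w; rewrite (period_end (r_run w) ti Kd).
    apply: (potential_convex _ _ sigma01).2; first exact: (period_x_fin w ti).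
    by case: (average_gap_ge w ti).
apply: le_trans hR _; have /andP[s0 s1] := sigma01.
move: hX hA A0 hG rho2; rewrite -/D0.
move: (mean P (fun w => potential (X t i.+1 w))) (mean P (average_gap t i.+1)).
move: (mean P (fun w => potential (period_average t i.+1 w))) (mcoef _ _ _ _) D0.
move=> b m D0 a g hX hA A0 hG rho2.
have D00 : 0 <= D0 by exact: le_trans hA.
have h1 : sigma * a <= sigma * (D0 - m * b) by apply: ler_wpM2l => //; lra.
have [hm|hm] := leP (1 - sigma - sigma * m) 0.
  have : (1 - sigma - sigma * m) * b <= 0 by rewrite mulr_le0_ge0.
  have : sigma * D0 <= rho * D0 by rewrite ler_wpM2r.
  by lra.
have : (1 - sigma - sigma * m) * b <= (1 - sigma - sigma * m) * D0.
  by rewrite ler_pM2l.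
have : (1 - sigma * m) * D0 <= rho * D0 by rewrite ler_wpM2r.
by lra.
Qed.

Lemma mcoef_ge0 j mu : 0 < mu -> 0 <= mcoef n tau j mu.
Proof.
move=> mu0; rewrite /mcoef; apply: mulr_ge0; last exact/ltW/Wsum_gt0.
apply: divr_ge0; first by apply: mulr_ge0; [exact: ltW|rewrite exprn_ge0// ltW].
by rewrite addr_ge0// mulr_ge0 ?subr_ge0// ltW.
Qed.

(** A restart follows each iteration whose index is a multiple of [K], so the periods start at [1],
    [K + 1], [2 K + 1], and so on, apart from the one consisting of iteration 0. *)
Lemma restart_time_block p i : (i < K)%N -> rt ((p * K).+1 + i) = (p * K).+1.
Proof.
elim: i => [|i IH] iK; first by rewrite addn0 /= dvdn_mull.
rewrite addnS /= ifF; first exact: IH (ltnW iK).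
apply/negP; rewrite addSn -addnS dvdn_addr ?dvdn_mull// => /(dvdn_leq (ltn0Sn i)).
by rewrite leqNgt iK.
Qed.

Lemma mean_potential_geometric rho k : (0 < K)%N ->
  sigma <= rho -> 1 - sigma * mcoef n tau K muF <= rho ->
  mean P (fun w => potential (run_x (r w) k)) <= rho ^+ (k.-1 %/ K) * potential x0.
Proof.
move=> K0 rho1 rho2; have /andP[s0 s1] := sigma01.
have r0 : 0 <= rho := le_trans s0 rho1.
have e0 : mean P (fun w => potential (run_x (r w) 0)) = potential x0.
  rewrite -[RHS](mean_cst P); congr mean; apply/funext => w.
  by case: (r_run w) => -> _ _.
case: k => [|k]; first by rewrite div0n expr0 mul1r e0.
have block p : mean P (fun w => potential (run_x (r w) (p * K).+1)) <= rho ^+ p * potential x0.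
  elim: p => [|p IH].
    (* Iteration 0 forms a period of length one, to which the bound on [mcoef n tau K] does not
       apply; rate 1 is enough here. *)
    rewrite expr0 -e0; have := @mean_potential_restart 0 0 1 erefl.
    by apply=> //; rewrite gerBl mulr_ge0// mcoef_ge0.
  have iK : (K.-1 < K)%N by rewrite prednK.
  have ti := restart_time_block p iK.
  have E : ((p * K).+1 + K.-1)%N = (p.+1 * K)%N by rewrite addSn -addnS prednK// mulSn addnC.
  have := mean_potential_restart ti _ rho1 (rho := rho); rewrite prednK// E.
  move=> /(_ (dvdn_mull _ (dvdnn K)) rho2) h; apply: le_trans h _.
  by rewrite exprS -mulrA ler_wpM2l.
have iK : (k %% K < K)%N by rewrite ltn_mod.
have ti := restart_time_block (k %/ K) iK.
apply: (le_trans _ (block (k %/ K)%N)).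
have {1}-> : k.+1 = ((k %/ K * K).+1 + k %% K)%N by rewrite addSn -divn_eq.
have := mean_potential_period ti (leqnSn _); congr (_ <= _); congr mean.
by apply/funext => w; case: (period_inside (r_run w) ti) => ->.
Qed.

End Period.

(** * The rate *)

Section Rate.
Context (R : realType) (n : nat) (tau mu muF : R) (K : nat).
Local Notation th0 := (tau / n%:R).
Hypothesis th0_gt0 : 0 < th0.
Hypothesis th0_le1 : th0 <= 1.
Hypothesis mu_gt0 : 0 < mu.
Hypothesis mu_le1 : mu <= 1.
Hypothesis muF_gt0 : 0 < muF.
Hypothesis KE : K%:Z = Num.ceil (2 * Num.sqrt 3 / th0 * Num.sqrt (1 + 1 / mu)
                                 - 2 / th0 + 1).

(** With this [q] the formula for [K] is the ceiling of [(q - 1) * 2 / th0 + 1], that is, the least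
    [K] for which [1 / th0 + (K - 1) / 2], the lower bound on [a_(K-1)], reaches [q / th0]. *)
Let q : R := Num.sqrt 3 * Num.sqrt (1 + 1 / mu).

Let q_ge0 : 0 <= q.
Proof. by rewrite mulr_ge0// sqrtr_ge0. Qed.

Let q_sqr : q ^+ 2 = 3 * (1 + 1 / mu).
Proof. by rewrite exprMn !sqr_sqrtr// addr_ge0// divr_ge0// ltW. Qed.

Let q_sqr_ge : 6 <= q ^+ 2.
Proof. by rewrite q_sqr; have : 1 <= 1 / mu by [rewrite div1r invf_ge1]; lra. Qed.

Let KE' : K%:Z = Num.ceil ((q - 1) * 2 * th0^-1 + 1).
Proof. by rewrite KE; congr Num.ceil; rewrite /q; ring. Qed.

Let K_ge : (q - 1) * 2 * th0^-1 + 1 <= K%:R.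
Proof. by rewrite -[K%:R]/((Posz K)%:~R) KE' ceil_ge. Qed.

Lemma restart_length_gt0 : (0 < K)%N.
Proof.
have q1 : 1 <= q.
  by rewrite leNgt; apply/negP => h; move: q_sqr_ge q_ge0 h; move: q => x; nra.
rewrite -(ltr0n R); apply: lt_le_trans K_ge.
by rewrite ltr_wpDl// !mulr_ge0 ?subr_ge0// invr_ge0 ltW.
Qed.

(** The ceiling adds less than 1 to the explicit [+ 1], and the total is absorbed by [- 2 / th0], as
    [th0 <= 1]. *)
Lemma restart_length_le : K%:R <= 2 * Num.sqrt 3 * Num.sqrt (1 + 1 / mu) / th0.
Proof.
have := ceilB1_lt ((q - 1) * 2 * th0^-1 + 1); rewrite -KE' intrB.
rewrite -[(Posz K)%:~R]/(K%:R : R) => h.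
have N1 : 1 <= th0^-1 by rewrite invf_ge1.
have -> : 2 * Num.sqrt 3 * Num.sqrt (1 + 1 / mu) / th0 = 2 * q / th0.
  by rewrite /q; ring.
by move: h N1; move: th0^-1 K%:R => N k; rewrite -[1%:~R]/(1 : R); lra.
Qed.

(** From [a_(K-1) >= q / th0] one gets [W_K >= (1 + 1 / mu) / th0^2], and the prefactor of [mcoef]
    turns this into [(1 + mu) / (1 + mu (1 - th0)) >= 1]. *)
Lemma mcoef_ge1 : 1 <= mcoef n tau K mu.
Proof.
have := K_ge; have := @Wsum_ge R n tau th0_gt0 th0_le1 K.-1.
have := inv_vtheta_ge th0_gt0 th0_le1 K.-1.
rewrite prednK ?restart_length_gt0//.
have -> : K.-1%:R = K%:R - 1 :> R.
  by rewrite -[in RHS](prednK restart_length_gt0) -natr1 addrK.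
set a := (vtheta _ _ _)^-1 => ha hW hK.
have N0 : 0 < th0^-1 by rewrite invr_gt0.
have qa : q * th0^-1 <= a by move: ha hK; move: th0^-1 => N; lra.
have qa2 : 3 * (1 + 1 / mu) * th0^-1 ^+ 2 <= a ^+ 2.
  rewrite -q_sqr -exprMn lerXn2r ?nnegrE//; first by rewrite mulr_ge0// ltW.
  by apply: le_trans qa; rewrite mulr_ge0// ltW.
have N2 : 0 < th0^-1 ^+ 2 by rewrite exprn_gt0.
have {}hW : (1 + 1 / mu) * th0^-1 ^+ 2 <= Wsum n tau K.
  apply: le_trans (hW _); first by move: qa2; lra.
  by apply: le_trans qa2; rewrite ler_wpM2r ?(ltW N2)// -q_sqr.
rewrite /mcoef.
have c0 : 0 < 1 + mu * (1 - th0) by rewrite ltr_wpDr// mulr_ge0 ?subr_ge0// ltW.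
have c1 : 0 < mu * th0 ^+ 2 / (1 + mu * (1 - th0)).
  by rewrite divr_gt0// mulr_gt0// exprn_gt0.
apply: le_trans (ler_wpM2l (ltW c1) hW).
have -> : mu * th0 ^+ 2 / (1 + mu * (1 - th0)) * ((1 + 1 / mu) * th0^-1 ^+ 2)
    = (1 + mu) / (1 + mu * (1 - th0)).
  move: th0 th0_gt0 c0 => h h0 c0; field.
  by rewrite !gt_eqF.
rewrite ler_pdivlMr// mul1r lerD2l ger_pMr// gerBl.
exact: ltW.
Qed.

Let eta : R := 2^-1 * Num.min 1 (muF / mu).

(** The map [h -> h / (1 + h (1 - th0))] is nondecreasing, which settles [mu <= muF]; it is also
    concave and vanishes at 0, so passing from [mu] down to [muF] loses at most the factor
    [muF / mu]. *)
Lemma mcoef_ratio j : Num.min 1 (muF / mu) * mcoef n tau j mu <= mcoef n tau j muF.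
Proof.
rewrite /mcoef mulrA; apply: ler_wpM2r; first exact/ltW/Wsum_gt0.
have c h : 0 < h -> 0 < 1 + h * (1 - th0).
  by move=> h0; rewrite ltr_wpDr// mulr_ge0 ?subr_ge0// ltW.
have t2 : 0 < th0 ^+ 2 by rewrite exprn_gt0.
rewrite mulrA ler_pdivrMr ?c// mulrAC ler_pdivlMr ?c//.
have u0 : 0 <= 1 - th0 by rewrite subr_ge0.
rewrite [leLHS](_ : _ = Num.min 1 (muF / mu) * mu * (1 + muF * (1 - th0)) * th0 ^+ 2); last by ring.
rewrite [leRHS](_ : _ = muF * (1 + mu * (1 - th0)) * th0 ^+ 2); last by ring.
rewrite ler_pM2r//.
have [h|h] := leP mu muF.
  have -> : Num.min 1 (muF / mu) = 1 by apply/min_idPl; rewrite ler_pdivlMr// mul1r.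
  by move: (1 - th0) u0 => u u0; nra.
have -> : Num.min 1 (muF / mu) = muF / mu.
  by apply/min_idPr; rewrite ler_pdivrMr// mul1r ltW.
rewrite divfK ?gt_eqF// ler_pM2l// lerD2l ler_wpM2r//.
exact: ltW.
Qed.

(** As [mcoef n tau K mu >= 1], one has [sigma <= 1/2], and [sigma * mcoef n tau K mu = 1 - sigma >=
    1/2]. Replacing [mu] by [muF] then costs the minimum in [eta]. *)
Lemma contraction_factor (sigma : R) : sigma = 1 / (1 + mcoef n tau K mu) ->
  [/\ 0 <= sigma <= 1, sigma <= 1 - eta & 1 - sigma * mcoef n tau K muF <= 1 - eta].
Proof.
move=> sE; have m1 := mcoef_ge1; have hr := mcoef_ratio K.
have c0 : 0 < 1 + mcoef n tau K mu by rewrite ltr_wpDr// (le_trans ler01).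
have s0 : 0 < sigma by rewrite sE divr_gt0.
have s2 : sigma <= 1 / 2 by rewrite sE ler_pdivrMr// mulrDr; move: m1; lra.
have min1 : Num.min 1 (muF / mu) <= 1 by rewrite ge_min lexx.
have min0 : 0 < Num.min 1 (muF / mu) by rewrite lt_min ltr01 divr_gt0.
have sm : 1 / 2 <= sigma * mcoef n tau K mu.
  have -> : sigma * mcoef n tau K mu = 1 - sigma.
    by rewrite sE; field; rewrite gt_eqF.
  by move: s2; lra.
split; first by rewrite ltW//=; move: s2; lra.
  by rewrite /eta; move: s2 min1; lra.
rewrite lerD2l lerN2; apply: le_trans (ler_wpM2l (ltW s0) hr).
by rewrite /eta mulrCA mulrC ler_pM2l//; move: sm; rewrite div1r.
Qed.

(* Here [sqrt mu * max (1 / sqrt mu) (sqrt mu / muF) * eta >= 1 / 2], so that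
   already [4 sqrt 6] in place of [6 sqrt 6] would do. *)
Lemma rate_bound (D eps : R) (k : nat) : 0 < eps -> 0 <= D ->
  (eps < D -> n%:R / tau * (6 * Num.sqrt 6
      * Num.max (1 / Num.sqrt mu) (Num.sqrt mu / muF) * ln (D / eps)
      + 2 * Num.sqrt 3 * Num.sqrt (1 + 1 / mu)) <= k%:R) ->
  (1 - eta) ^+ (k.-1 %/ K) * D <= eps.
Proof.
move=> eps0 D0 hk.
have min1 : Num.min 1 (muF / mu) <= 1 by rewrite ge_min lexx.
have min0 : 0 < Num.min 1 (muF / mu) by rewrite lt_min ltr01 divr_gt0.
have eta0 : 0 < eta by rewrite mulr_gt0.
have eta1 : 0 <= 1 - eta by rewrite /eta; move: min1; lra.
(* If [D <= eps] the logarithm is not positive and the bound on [k] carries no information, but the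
   factor is at most 1. *)
have [De|De] := leP D eps.
  apply: le_trans De; rewrite ler_piMl// exprn_ile1//.
  by rewrite gerBl ltW.
have {}hk := hk De; set p := (k.-1 %/ K)%N.
have l0 : 0 < ln (D / eps) by rewrite ln_gt0// ltr_pdivlMr// mul1r.
set l := ln (D / eps) in hk l0.
(* The last [K] covers both the incomplete period and iteration 0; by [restart_length_le] it is at
   most the additive term in the bound on [k]. *)
have kp : k%:R <= p%:R * K%:R + K%:R :> R.
  rewrite -natrM -natrD ler_nat -mulSnr.
  case: k {hk} @p => [//|k] /=; exact: ltn_ceil restart_length_gt0.
have sm0 : 0 < Num.sqrt mu by rewrite sqrtr_gt0.
have N0 : 0 < th0^-1 by rewrite invr_gt0.
(* Since [mu <= 1], [3 (1 + 1 / mu) <= 6 / mu]; this is where [sqrt 6] comes from. *)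
have Kle : K%:R <= 2 * Num.sqrt 6 / Num.sqrt mu * th0^-1.
  apply: le_trans restart_length_le _; rewrite ler_pM2r// -!mulrA ler_pM2l//.
  rewrite ler_pdivlMr// -!sqrtrM//; last by rewrite mulr_ge0// addr_ge0// divr_ge0// ltW.
  have -> : 3 * (1 + 1 / mu) * mu = 3 * (mu + 1) by field; rewrite gt_eqF.
  by rewrite ler_sqrt//; move: mu_le1; lra.
set M := Num.max _ _ in hk.
have Meta : 1 / 2 <= Num.sqrt mu * M * eta.
  rewrite /M /eta; have [h|h] := leP mu muF.
    have -> : Num.min 1 (muF / mu) = 1 by apply/min_idPl; rewrite ler_pdivlMr// mul1r.
    rewrite mulr1 div1r ler_peMl// -[leLHS](@divff _ (Num.sqrt mu)) ?gt_eqF//.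
    by rewrite ler_pM2l// div1r le_max lexx.
  have -> : Num.min 1 (muF / mu) = muF / mu.
    by apply/min_idPr; rewrite ler_pdivrMr// mul1r ltW.
  have : Num.sqrt mu / muF <= M by rewrite le_max lexx orbT.
  rewrite -/M => hM; have e0 : 0 < 2^-1 * (muF / mu) by rewrite mulr_gt0 ?divr_gt0.
  apply: le_trans (ler_wpM2r (ltW e0) (ler_wpM2l (ltW sm0) hM)).
  rewrite [leRHS](_ : _ = Num.sqrt mu ^+ 2 / mu / 2).
    by rewrite sqr_sqrtr ?(ltW mu_gt0)// divff ?gt_eqF.
  by field; rewrite !gt_eqF.
have pl : l <= p%:R * eta.
  have s6 : 0 < Num.sqrt 6 :> R by rewrite sqrtr_gt0.
  have hK := restart_length_le.
  have M0 : 0 < M by rewrite lt_max divr_gt0.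
  have h1 : th0^-1 * (6 * Num.sqrt 6 * M * l) <= p%:R * (2 * Num.sqrt 6 / Num.sqrt mu * th0^-1).
    apply: (@le_trans _ _ (p%:R * K%:R)); last by rewrite ler_wpM2l.
    move: hk hK kp; rewrite -[n%:R / tau]invf_div.
    move: th0^-1 (Num.sqrt 3) (Num.sqrt (1 + _)) => N s3 s1; lra.
  have h2 : 3 * Num.sqrt mu * M * l <= p%:R.
    have c0 : 0 < 2 * Num.sqrt 6 / Num.sqrt mu * th0^-1.
      by rewrite !mulr_gt0// invr_gt0.
    rewrite -(ler_pM2r c0); apply: le_trans h1.
    rewrite le_eqVlt; apply/orP; left; apply/eqP.
    by move: th0^-1 => N; field; rewrite gt_eqF.
  have h3 := ler_wpM2r (ltW eta0) h2.
  apply: le_trans h3.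
  have -> : 3 * Num.sqrt mu * M * l * eta = 3 * l * (Num.sqrt mu * M * eta) by ring.
  have h4 : 3 * l * (1 / 2) <= 3 * l * (Num.sqrt mu * M * eta) by rewrite ler_pM2l// mulr_gt0.
  by apply: le_trans h4; move: l0; lra.
have e1 : 1 - eta <= expR (- eta) by exact: expR_ge1Dx.
have e2 : (1 - eta) ^+ p <= expR (- l).
  apply: (@le_trans _ _ (expR (- eta) ^+ p)).
    by rewrite lerXn2r ?nnegrE ?expR_ge0.
  by rewrite -expRM_natl ler_expR mulrN lerN2.
apply: le_trans (ler_wpM2r D0 e2) _.
have D1 : 0 < D := lt_trans eps0 De.
rewrite expRN /l lnK ?posrE ?divr_gt0// invf_div.
by rewrite divfK// gt_eqF.
Qed.

End Rate.

(** * The sampling *)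

Section Sampling.
Context (R : realType) (n : nat) d (T : measurableType d) (P : probability T R).
Context (Shat : T -> {set 'I_n}) (tau : R).
Hypothesis Shat_meas : discrete_measurable_map Shat.
Hypothesis Shat_uniform : forall i j : 'I_n,
  P [set w | i \in Shat w] = P [set w | j \in Shat w].
Hypothesis tauE : 'E_P[fun w => #|Shat w|%:R]%E = tau%:E.
Hypothesis tau_gt0 : 0 < tau.

Definition sampling_weight (A : {set 'I_n}) : R := fine (P (Shat @^-1` [set A])).
Local Notation pr := sampling_weight.

Lemma expectation_sampling (g : {set 'I_n} -> R) :
  'E_P[fun w => g (Shat w)]%E = (\sum_A pr A * g A)%:E.
Proof. by rewrite expectation.unlock integral_finite_map. Qed.

Lemma sampling_weightE A : P (Shat @^-1` [set A]) = (pr A)%:E.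
Proof. by rewrite fineK// fin_num_measure//; exact: Shat_meas. Qed.

Lemma sampling_weight_sum : \sum_A pr A = 1.
Proof.
apply: EFin_inj; under eq_bigr do rewrite -[pr _]mulr1.
by rewrite -(expectation_sampling (fun=> 1)) expectation_cst.
Qed.

Lemma sampling_size_mean : \sum_A pr A * #|A|%:R = tau.
Proof.
by apply: EFin_inj; rewrite -tauE (expectation_sampling (fun A => #|A|%:R)).
Qed.

(** The mean size [tau] is the sum of the [n] marginals, which uniformity makes equal. *)
Lemma sampling_weight_marginal i : \sum_(A : {set 'I_n} | i \in A) pr A = tau / n%:R.
Proof.
have mem j : \sum_(A : {set 'I_n} | j \in A) pr A = fine (P [set w | j \in Shat w]).
  apply: EFin_inj; rewrite fineK; last first.
    by rewrite fin_num_measure//; exact: (Shat_meas (fun A => j \in A)).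
  rewrite big_mkcond/=.
  transitivity ('E_P[fun w => (j \in Shat w)%:R])%E.
    rewrite (expectation_sampling (fun A => (j \in A)%:R)); congr EFin.
    by apply: eq_bigr => A _; case: ifP; rewrite ?mulr1 ?mulr0.
  have <- : (\int[P]_w (\1_[set w | j \in Shat w] w)%:E)%E = P [set w | j \in Shat w].
    by rewrite integral_indic ?setIT//; exact: (Shat_meas (fun A => j \in A)).
  rewrite expectation.unlock; apply: eq_integral => w _; rewrite indicE.
  by congr ((nat_of_bool _)%:R)%:E; apply/idP/idP; rewrite inE.
have sumE : n%:R * \sum_(A : {set 'I_n} | i \in A) pr A = tau.
  rewrite -[RHS]sampling_size_mean.
  transitivity (\sum_(j < n) \sum_(A : {set 'I_n} | j \in A) pr A).
    rewrite [RHS](eq_bigr (fun=> \sum_(A : {set 'I_n} | i \in A) pr A)); last first.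
      by move=> j _; rewrite !mem; congr fine; exact: Shat_uniform.
    by rewrite big_const_ord iter_addr_0 mulr_natl.
  rewrite (exchange_big_dep predT)//=; apply: eq_bigr => A _.
  by rewrite sumr_const mulr_natr.
have n0 : n%:R != 0 :> R.
  by apply/eqP => n0; move: tau_gt0; rewrite -sumE n0 mul0r ltxx.
by rewrite -sumE mulrC mulKf.
Qed.

Lemma sampling_size_gt0 : (0 < n)%N.
Proof.
case: (posnP n) => // n0.
move: tau_gt0; rewrite -sampling_size_mean big1 ?ltxx// => A _.
have := max_card (mem A); rewrite card_ord [X in (_ <= X)%N -> _]n0 leqn0 => /eqP ->.
by rewrite mulr0.
Qed.

Lemma sampling_rate_gt0 : 0 < tau / n%:R.
Proof. by rewrite divr_gt0// ltr0n sampling_size_gt0. Qed.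

Lemma sampling_rate_le1 : tau / n%:R <= 1.
Proof.
have i := Ordinal sampling_size_gt0.
rewrite -(sampling_weight_marginal i) -sampling_weight_sum big_mkcond/=.
by apply: ler_sum => A _; case: ifP => // _; rewrite fine_ge0.
Qed.

End Sampling.


Theorem corollary1
  (R : realType) (n : nat)
  (f : 'rV[R]_n -> R) (psi : 'I_n -> R -> \bar R)
  (f_convex : @convex_function R 'rV[R]_n setT f)
  (f_diff : forall x : 'rV[R]_n, differentiable f x)
  (psi_cc : forall i : 'I_n, closed_convex (psi i))
  (xs : 'rV[R]_n) (xs_min : is_minimizer (objective f psi) xs)
  (v : 'I_n -> R) (v_gt0 : forall i : 'I_n, 0 < v i)
  (muF : R) (muF_gt0 : 0 < muF)
  (strong_convexity : forall x : 'rV[R]_n,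
     (objective f psi xs + (muF / 2 * wnorm2 v (x - xs))%:E
        <= objective f psi x)%E)
  (d : measure_display) (T : measurableType d) (P : probability T R)
  (Shat : T -> {set 'I_n}) (Shat_meas : discrete_measurable_map Shat)
  (Shat_uniform : forall i j : 'I_n,
     P [set w | i \in Shat w] = P [set w | j \in Shat w])
  (tau : R) (tauE : 'E_P[fun w => #|Shat w|%:R]%E = tau%:E) (tau_gt0 : 0 < tau)
  (ESO : forall x h : 'rV[R]_n,
     ('E_P[fun w => f (x + restrict_to (Shat w) h)%R]
       <= (f x + tau / n%:R * (\sum_(i < n) partial f i x * h 0 i
                               + 1 / 2 * wnorm2 v h))%:E)%E)
  (S : nat -> T -> {set 'I_n})
  (S_meas : forall k : nat, discrete_measurable_map (S k))
  (S_law : forall k : nat, same_law P (S k) Shat)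
  (S_indep : mutually_independent P S)
  (mu : R) (mu_gt0 : 0 < mu) (mu_le1 : mu <= 1)
  (eps : R) (eps_gt0 : 0 < eps)
  (K : nat)
  (KE : K%:Z = Num.ceil (2 * Num.sqrt 3 / (tau / n%:R) * Num.sqrt (1 + 1 / mu)
                         - 2 / (tau / n%:R) + 1))
  (sigma : R) (sigmaE : sigma = 1 / (1 + mcoef n tau K mu))
  (x0 : 'rV[R]_n) (x0_dom : edom (separable psi) x0)
  (x : nat -> T -> 'rV[R]_n)
  (x_iter : forall w : T,
     approx_restart f psi v tau K sigma x0 (fun k => S k w) (fun k => x k w))
  (k : nat)
  (k_ge : ((n%:R / tau)%:E
            * ((6 * Num.sqrt 6
                  * Num.max (1 / Num.sqrt mu) (Num.sqrt mu / muF))%:E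
               * lne (Dfun f psi v tau xs x0 * (eps^-1)%:E)
               + (2 * Num.sqrt 3 * Num.sqrt (1 + 1 / mu))%:E)
           <= (k%:R)%:E)%E) :
  (\int[P]_w ((1 - tau / n%:R)%:E
                * (objective f psi (x k w) - objective f psi xs)
              + (1 / 2 * wnorm2 v (x k w - xs))%:E)
   <= eps%:E)%E.
Proof.
pose pr := sampling_weight P Shat.
have th0_gt0 := sampling_rate_gt0 Shat_meas tauE tau_gt0.
have th0_le1 := sampling_rate_le1 Shat_meas Shat_uniform tauE tau_gt0.
have pr_marginal := sampling_weight_marginal Shat_meas Shat_uniform tauE tau_gt0.
have pr_sum := sampling_weight_sum P Shat_meas.
have S_pr j A : P (S j @^-1` [set A]) = (pr A)%:E.
  by rewrite S_law; exact: sampling_weightE.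
have eso y h : \sum_A pr A * f (y + restrict_to A h)
    <= f y + tau / n%:R * (\sum_(i < n) partial f i y * h 0 i + 1 / 2 * wnorm2 v h).
  rewrite -lee_fin; apply: le_trans (ESO y h).
  by rewrite (expectation_sampling _ Shat_meas (fun A => f (y + restrict_to A h))).
have x0_fin : finite_at psi x0 by exact: finite_at_ltyP.
have xs_fin : finite_at psi xs.
  apply: finite_at_ltyP => //; have := xs_min x0.
  rewrite (objective_fineE f x0_fin) /objective.
  by case: (separable psi xs) => [s| |]; rewrite ?ltry.
have growth y : finite_at psi y ->
    objective_fine f psi xs + muF / 2 * wnorm2 v (y - xs) <= objective_fine f psi y.
  move=> yf; have := strong_convexity y.
  by rewrite !objective_fineE// -EFinD lee_fin.
(* The total mass 1 makes [T] nonempty, which provides the default outcome for [hist_rep]. *)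
have [w0 _] : exists w : T, True.
  apply: contrapT => none; have := @probability_setT _ _ _ P.
  rewrite (_ : [set: T] = set0); last first.
    by apply/seteqP; split=> w // _; apply: none; exists w.
  by rewrite measure0 => /esym/eqP; rewrite onee_eq0.
have [sigma01 sigma_le mF_le] := contraction_factor th0_gt0 th0_le1 mu_gt0 mu_le1
  muF_gt0 KE sigmaE.
have K0 := restart_length_gt0 th0_gt0 mu_gt0 mu_le1 KE.
have /choice[r Hr] : forall w, exists rw, is_run f psi v tau K sigma x0 (fun k => S k w) rw
    /\ run_x rw = fun k => x k w.
  by move=> w; have [rw h1 h2] := approx_restart_run (x_iter w); exists rw.
have r_run w : is_run f psi v tau K sigma x0 (fun k => S k w) (r w) by case: (Hr w).
have xE w j : x j w = run_x (r w) j by case: (Hr w) => _ ->.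
have DE y : finite_at psi y -> Dfun f psi v tau xs y = (potential f psi v tau xs y)%:E.
  by move=> yf; rewrite /Dfun !objective_fineE// -EFinB -EFinM -EFinD.
have -> : (\int[P]_w ((1 - tau / n%:R)%:E
                * (objective f psi (x k w) - objective f psi xs)
              + (1 / 2 * wnorm2 v (x k w - xs))%:E)
    = \int[P]_w (potential f psi v tau xs (run_x (r w) k))%:E)%E.
  apply: eq_integral => w _; rewrite xE -DE//.
  exact: (run_finite f_convex psi_cc th0_gt0 th0_le1 sigma01 x0_fin (r_run w) k).1.
have adapted_x : adapted S k (fun w => potential f psi v tau xs (run_x (r w) k)).
  move=> w w' e.
  have [/(_ k (leqnn k))[-> _] _] := run_adapted f_convex psi_cc v_gt0 tau_gt0 th0_gt0
    th0_le1 sigma01 x0_fin r_run e.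
  by [].
rewrite (mean_integral w0 S_meas S_pr S_indep adapted_x) lee_fin.
apply: le_trans (mean_potential_geometric f_convex f_diff psi_cc v_gt0 tau_gt0
  th0_gt0 th0_le1 sigma01 x0_fin xs_fin muF_gt0 growth w0 S_meas S_pr S_indep pr_sum
  pr_marginal eso r_run k K0 sigma_le mF_le) _.
apply: (rate_bound th0_gt0 th0_le1 mu_gt0 mu_le1 muF_gt0 KE eps_gt0).
  exact: (potential_ge0 v_gt0 th0_le1 muF_gt0 growth x0_fin).
(* Only the case [eps < D(x_0)] calls for the bound on [k]; there the argument of [lne] is positive
   and [lne] is the real logarithm. *)
move=> De; move: k_ge; rewrite DE// -EFinM /lne ifF; last first.
  apply/negbTE; rewrite -ltNge mulr_gt0 ?invr_gt0//; exact: lt_trans De.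
by rewrite -EFinM lee_fin.
Qed.
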